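(* If $\sigma:M\times G\to M$ is a smooth right action of a Lie group $G$ on a finite-dimensional manifold $M$ (possibly with boundary) and $E$ is a locally convex space, then the induced left action $$\alpha:G\times C^{\infty}(M,E)\to C^{\infty}(M,E),\qquad \alpha(g,f)(m):=(g.f)(m):=f(\sigma(m,g))$$ of $G$ on the locally convex space $C^{\infty}(M,E)$ is smooth.
   Context: Manifolds are finite-dimensional, paracompact, second countable and smooth. $C^{\infty}(M,E)$ carries the smooth compact open topology, i.e. the initial topology with respect to the embedding $C^{\infty}(M,E)\hookrightarrow\prod_{n\in\mathbb{N}_0}C(T^nM,T^nE)$, $f\mapsto(T^nf)_{n\in\mathbb{N}_0}$, where $T^n$ denotes the $n$-fold iterated tangent functor and the spaces $C(T^nM,T^nE)$ carry the compact open topology. Smoothness of maps between locally convex spaces and manifolds is in the sense of calculus on locally convex spaces (all iterated directional derivatives exist and are jointly continuous). *)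

(* Defs.v *)
From HB Require Import structures.
From mathcomp Require Import all_boot all_order all_algebra.
From mathcomp Require Import all_classical all_reals all_analysis.

Set Implicit Arguments.
Unset Strict Implicit.
Unset Printing Implicit Defensive.

Import Order.TTheory GRing.Theory Num.Theory.
Import numFieldNormedType.Exports.

Local Open Scope classical_set_scope.
Local Open Scope ring_scope.

HB.instance Definition _ (R : realType) (V W : preTopologicalLmodType R) :=
  Topological.on (V * W)%type.
HB.instance Definition _ (R : realType) (m n : nat) :=
  Topological.on 'M[R]_(m, n).

(* The calculus is stated for real vector spaces with a topology, without
   compatibility axioms, so that it applies to C^oo(M, E) below without first
   having to prove that the latter is a topological vector space. *)

Section calculus.
Context {R : realType} {V W : preTopologicalLmodType R}.

(* [smooth_on D f] is meant for sets D with dense interior: the iterated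
   directional derivatives
     d n (x, (v_0, ..., v_(n-1))) = D_(v_(n-1)) ... D_(v_0) f (x)
   exist on the interior of D and extend to continuous maps on D x V^n.
   When D is open these are just the jointly continuous iterated directional
   derivatives of f. Outside D x V^n the values of d are irrelevant. *)
Definition smooth_on (D : set V) (f : V -> W) : Prop :=
  exists d : forall n : nat, V * {ptws 'I_n -> V} -> W,
    [/\ forall n, {within D `*` setT, continuous (d n)},
        forall x v, D x -> d 0%N (x, v) = f x
      & forall n x (v : 'I_n.+1 -> V), D° x ->
          h^-1 *: (d n (x + h *: v ord_max, fun i => v (widen_ord (leqnSn n) i))
                   - d n (x, fun i => v (widen_ord (leqnSn n) i)))
            @[h --> (0 : R)^'] --> d n.+1 (x, v)].

Definition dir_derive (f : V -> W) (x v : V) : W :=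
  xget 0 [set l | h^-1 *: (f (x + h *: v) - f x) @[h --> (0 : R)^'] --> l].

(* The derivative df(x)(v) at a point x of D, possibly on the boundary of D: the
   value at x of the continuous extension of the derivative from D°. *)
Definition derive_within (D : set V) (f : V -> W) (x v : V) : W :=
  xget 0 [set l | dir_derive f y v @[y --> within D° (nbhs x)] --> l].

End calculus.

(* An atlas on the set T; its axioms are in [is_manifold] below, so that
   tangent and product atlases can be formed first. [chart_inv i] only matters
   on the image of [dom i]. [chart_at p] is a choice of a chart around p. *)
Record atlas (R : realType) (T : Type) (V : preTopologicalLmodType R) := Atlas {
  chart_index : Type;
  dom : chart_index -> set T;
  chart : chart_index -> T -> V;
  chart_inv : chart_index -> V -> T;
  chart_at : T -> chart_index }.

(* T with the topology induced by the atlas: a set is open iff its image under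
   each chart is open relatively to the image of that chart. *)
Definition mfd (R : realType) (T : Type) (V : preTopologicalLmodType R)
  (A : atlas T V) : Type := T.

Section mfd_topology.
Context {R : realType} {T : Type} {V : preTopologicalLmodType R}.
Variable A : atlas T V.

Definition mfd_open : set_system (mfd A) := [set O | forall i : chart_index A,
  exists2 W : set V, open W & forall p, dom i p -> O p <-> W (chart i p)].

Lemma mfd_openT : mfd_open setT.
Proof. by move=> i; exists setT; [exact: openT|]. Qed.

Lemma mfd_openI : setI_closed mfd_open.
Proof.
move=> O1 O2 h1 h2 i; have [W1 oW1 e1] := h1 i; have [W2 oW2 e2] := h2 i.
exists (W1 `&` W2); first exact: openI.
move=> p ip; split=> -[].
  by move=> /(e1 p ip) ? /(e2 p ip).
by move=> /(e1 p ip) ? /(e2 p ip).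
Qed.

Lemma mfd_open_bigU (I : Type) (O : I -> set (mfd A)) :
  (forall k, mfd_open (O k)) -> mfd_open (\bigcup_k O k).
Proof.
move=> oO i.
have /choice[W hW] : forall k, exists W : set V,
    open W /\ forall p, dom i p -> O k p <-> W (chart i p).
  by move=> k; have [W oW e] := oO k i; exists W.
exists (\bigcup_k W k); first by apply: bigcup_open => k _; exact: (hW k).1.
by move=> p ip; split=> -[k _ /((hW k).2 p ip)]; exists k.
Qed.

HB.instance Definition _ := gen_eqMixin (mfd A).
HB.instance Definition _ := gen_choiceMixin (mfd A).
HB.instance Definition _ :=
  isOpenTopological.Build (mfd A) mfd_openT mfd_openI mfd_open_bigU.

End mfd_topology.

(* A smooth manifold modelled on the subset S of V: the charts are bijections
   onto relatively open subsets of S, with smooth changes of charts. *)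
Definition is_manifold (R : realType) (T : Type) (V : preTopologicalLmodType R)
    (S : set V) (A : atlas T V) : Prop :=
  [/\ forall p, dom (chart_at A p) p,
      forall (i : chart_index A) p, dom i p -> chart_inv i (chart i p) = p,
      forall i j : chart_index A, exists2 O : set V,
        open O & chart i @` (dom i `&` dom j) = O `&` S,
      forall i j : chart_index A,
        smooth_on (chart i @` (dom i `&` dom j)) (chart j \o chart_inv i)
    & hausdorff_space (mfd A)].

Definition paracompact (X : topologicalType) : Prop :=
  hausdorff_space X /\
  forall U : set (set X), U `<=` open -> \bigcup_(O in U) O = setT ->
    exists W : set (set X),
      [/\ W `<=` open, \bigcup_(O in W) O = setT,
          forall O, W O -> exists2 O', U O' & O `<=` O'
        & forall x : X, exists2 N, nbhs x N &
            finite_set [set O | W O /\ O `&` N !=set0]].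

(* {x in R^d | x_0 >= 0}; all of R^0 when d = 0. *)
Definition half_space (R : realType) (d : nat) : set 'rV[R]_d :=
  [set x | forall i : 'I_d, i = 0%N :> nat -> 0 <= x ord0 i].

Definition is_fin_manifold_with_boundary (R : realType) (d : nat) (T : Type)
    (A : atlas T 'rV[R]_d) : Prop :=
  [/\ is_manifold (@half_space R d) A,
      paracompact (mfd A) & second_countable (T := mfd A)].

Definition smooth_map (R : realType) (T1 T2 : Type)
    (V1 V2 : preTopologicalLmodType R) (A1 : atlas T1 V1) (A2 : atlas T2 V2)
    (f : T1 -> T2) : Prop :=
  continuous (f : mfd A1 -> mfd A2) /\
  forall (i : chart_index A1) (j : chart_index A2),
    smooth_on (chart i @` (dom i `&` f @^-1` dom j))
              (chart j \o f \o chart_inv i).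

Definition space_atlas (R : realType) (V : preTopologicalLmodType R) :
    atlas V V :=
  {| chart_index := unit; dom := fun=> setT; chart := fun=> id;
     chart_inv := fun=> id; chart_at := fun=> tt |}.

Definition prod_atlas (R : realType) (T1 T2 : Type)
    (V1 V2 : preTopologicalLmodType R) (A1 : atlas T1 V1) (A2 : atlas T2 V2) :
    atlas (T1 * T2) (V1 * V2)%type :=
  {| chart_index := chart_index A1 * chart_index A2;
     dom := fun i => dom i.1 `*` dom i.2;
     chart := fun i p => (chart i.1 p.1, chart i.2 p.2);
     chart_inv := fun i x => (chart_inv i.1 x.1, chart_inv i.2 x.2);
     chart_at := fun p => (chart_at A1 p.1, chart_at A2 p.2) |}.

Definition is_lie_group (R : realType) (G : groupType)
    (V : preTopologicalLmodType R) (A : atlas G V) : Prop :=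
  [/\ is_manifold setT A,
      smooth_map (prod_atlas A A) A (fun p => p.1 * p.2)%g
    & smooth_map A A (fun g => g^-1)%g].

Definition is_right_action (T : Type) (G : groupType) (s : T * G -> T) : Prop :=
  (forall m, s (m, 1%g) = m) /\
  (forall m g h, s (s (m, g), h) = s (m, (g * h)%g)).

Definition is_left_action (G : groupType) (T : Type) (a : G * T -> T) : Prop :=
  (forall f, a (1%g, f) = f) /\
  (forall g h f, a (g, a (h, f)) = a ((g * h)%g, f)).

Section tangent.
Context {R : realType}.

(* A tangent vector at p is represented by its coordinates
   v : V in the chart [chart_at A p], so that the underlying set of TM is T * V;
   the chart of TM associated with a chart phi of M is
   T phi : (p, v) |-> (phi p, d(phi o (chart_at p)^-1)(chart_at p p)(v)). *)
Definition tangent_atlas (T : Type) (V : preTopologicalLmodType R)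
    (A : atlas T V) : atlas (T * V) (V * V)%type :=
  let dtrans (i j : chart_index A) := derive_within
    (chart i @` (dom i `&` dom j)) (chart j \o chart_inv i) in
  {| chart_index := chart_index A;
     dom := fun i => dom i `*` setT;
     chart := fun i pv => let c := chart_at A pv.1 in
       (chart i pv.1, dtrans c i (chart c pv.1) pv.2);
     chart_inv := fun i xw => let p := chart_inv i xw.1 in
       (p, dtrans i (chart_at A p) xw.1 xw.2);
     chart_at := fun pv => chart_at A pv.1 |}.

(* Tf : TM -> TE = E x E for f : M -> E. *)
Definition tangent_map (T : Type) (V E : preTopologicalLmodType R)
    (A : atlas T V) (f : T -> E) (pv : T * V) : E * E :=
  let c := chart_at A pv.1 in
  (f pv.1, derive_within (chart c @` dom c) (f \o chart_inv c)
             (chart c pv.1) pv.2).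

Fixpoint iter_double (n : nat) (E : preTopologicalLmodType R) :
    preTopologicalLmodType R :=
  if n is k.+1 then iter_double k (E * E)%type else E.

Fixpoint iter_tangent (n : nat) (T : Type) (V : preTopologicalLmodType R) :
    Type :=
  if n is k.+1 then iter_tangent k (T * V) (V * V)%type else T.

Fixpoint iter_tangent_atlas (n : nat) (T : Type)
    (V : preTopologicalLmodType R) (A : atlas T V) :
    atlas (iter_tangent n T V) (iter_double n V) :=
  match n with
  | 0 => A
  | k.+1 => iter_tangent_atlas k (tangent_atlas A)
  end.

(* T^n f : T^n M -> T^n E = E^(2^n). *)
Fixpoint iter_tangent_map (n : nat) (T : Type) (V E : preTopologicalLmodType R)
    (A : atlas T V) (f : T -> E) : iter_tangent n T V -> iter_double n E :=
  match n with
  | 0 => f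
  | k.+1 => iter_tangent_map (tangent_atlas A) (tangent_map A f)
  end.

End tangent.

Section smooth_functions.
Context {R : realType} {T : Type} {V : preTopologicalLmodType R}.
Variables (A : atlas T V) (E : tvsType R).

Definition smooth_pred : {pred T -> E} :=
  fun f => `[< smooth_map A (space_atlas E) f >].

Record smooth_fun := SmoothFun {
  smooth_val :> T -> E;
  smooth_valP : smooth_val \in smooth_pred }.

HB.instance Definition _ := [isSub for smooth_val].
HB.instance Definition _ := [Choice of smooth_fun by <:].

Lemma smooth_on_lin (D : set V) (a : R) (f g : V -> E) :
  smooth_on D f -> smooth_on D g -> smooth_on D (fun x => a *: f x + g x).
Proof.
move=> [df [fc f0 fS]] [dg [gc g0 gS]].
have linc (X : Type) (F : set_system X) (u v : X -> E) (l k : E) :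
    Filter F -> u @ F --> l -> v @ F --> k ->
    (fun x => a *: u x + v x) @ F --> a *: l + k.
  move=> FF ul vk.
  have aul : (fun x => a *: u x) @ F --> a *: l.
    exact: (cvg_comp2 (cvg_cst (a : R^o)) ul (@scale_continuous R E (a, l))).
  exact: (cvg_comp2 aul vk (@add_continuous E (a *: l, k))).
exists (fun n z => a *: df n z + dg n z); split.
- by move=> n z; exact: (linc _ _ _ _ _ _ _ (fc n z) (gc n z)).
- by move=> x v Dx; rewrite f0// g0.
- move=> n x v Dx.
  apply: cvg_trans (linc _ _ _ _ _ _ _ (fS n x v Dx) (gS n x v Dx)).
  apply: near_eq_cvg; near=> h => /=.
  rewrite [in RHS]opprD [in RHS]addrACA [RHS]scalerDr -[in RHS]scalerBr.
  by rewrite !scalerA [a * _]mulrC.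
Unshelve. all: by end_near. Qed.

Lemma smooth_submod_closed : GRing.submod_closed smooth_pred.
Proof.
have openP (O : set (mfd (space_atlas E))) : open O -> open (O : set E).
  move=> /(_ tt)[W oW OW].
  suff -> : (O : set E) = W by [].
  by apply/seteqP; split=> p /OW; apply.
have nbhsP (p : E) (N : set E) :
    nbhs (p : mfd (space_atlas E)) N <-> nbhs p N.
  rewrite !nbhsE; split=> -[B [oB Bp] BN]; exists B => //; split=> //.
    exact: openP.
  by move=> i; exists B.
split.
  apply/asboolP; split.
    move=> p N /= N0; apply: filterS (@filterT _ (nbhs (p : mfd A)) _) => q _.
    exact: (@nbhs_singleton (mfd (space_atlas E)) _ _ N0).
  move=> i j; exists (fun _ _ => 0); split=> //.
    by move=> n; apply: continuous_subspaceT => z; exact: cvg_cst.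
  move=> n x v _; apply: cvg_trans (@cvg_cst _ (0 : E) _ (0 : R)^' _).
  by apply: near_eq_cvg; near=> h; rewrite subr0 scaler0.
move=> a f g /asboolP[fc fS] /asboolP[gc gS]; apply/asboolP; split; last first.
  by move=> i j; have := smooth_on_lin a (fS i tt) (gS i tt).
move=> p N /nbhsP hN.
have [[B1 B2] /= [nB1 nB2] BN] := @add_continuous E (a *: f p, g p) _ hN.
have [[C1 C2] /= [nC1 nC2] CB] := @scale_continuous R E (a, f p) _ nB1.
have h1 : nbhs (p : mfd A) (f @^-1` C2) by apply: fc; apply/nbhsP.
have h2 : nbhs (p : mfd A) (g @^-1` B2) by apply: gc; apply/nbhsP.
apply: filterS2 h1 h2 => q hf hg.
apply: (BN (a *: f q, g q)); split=> //=.
apply: (CB (a, f q)); split=> //=.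
exact: (nbhs_singleton nC1).
Unshelve. all: by end_near. Qed.

HB.instance Definition _ :=
  GRing.isSubmodClosed.Build R (T -> E) smooth_pred smooth_submod_closed.
HB.instance Definition _ :=
  [SubChoice_isSubLmodule of smooth_fun by <:].

(* C^oo(M, E) -> prod_n C(T^n M, T^n E), f |-> (T^n f)_n, the target being
   extended to all maps T^n M -> T^n E. *)
Definition smooth_jets (f : smooth_fun) :
    prod_topology (fun n : nat =>
      {compact-open, mfd (iter_tangent_atlas n A) -> iter_double n E}) :=
  fun n => iter_tangent_map A f.

HB.instance Definition _ :=
  Topological.copy smooth_fun (initial_topology smooth_jets).

End smooth_functions.

Notation "''Cinfty' ( A , E )" := (smooth_fun A E)
  (format "''Cinfty' ( A ,  E )") : type_scope.

(* Main.v *)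
Require Import Defs.
From HB Require Import structures.
From mathcomp Require Import all_boot all_order all_algebra.
From mathcomp Require Import all_classical all_reals all_analysis.

Set Implicit Arguments.
Unset Strict Implicit.
Unset Printing Implicit Defensive.

Import Order.TTheory GRing.Theory Num.Theory.
Import numFieldNormedType.Exports.

Local Open Scope classical_set_scope.
Local Open Scope ring_scope.

(* In a chart phi of G the action is F(x, f) = f o sigma(-, phi^-1(x)). In charts
   of M, F(x, f)(y) is the evaluation map (f, z) |-> f(z) after a smooth map, and
   evaluation C^oo(M, E) x M -> E is smooth because M is locally compact; so
   (x, f, y) |-> F(x, f)(y) is smooth. By one half of the exponential law, a map
   Z x M -> E that is smooth in all variables induces a smooth map
   Z -> C^oo(M, E): its difference quotients converge together with their
   iterated tangent maps in M, uniformly on compact sets, since partial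
   derivatives along Z and along M commute.

   All this is done with strict derivatives, i.e. limits of difference quotients
   whose base point and direction vary as well. For them the chain rule and the
   locally uniform convergence of difference quotients are immediate, also at
   boundary points; the mean value theorem shows that continuous directional
   derivatives are strict. *)

(** * Limits and topological vector spaces *)

(** [smooth_on] speaks of iterated directional derivatives with separate directions, whereas tangent
    maps and the exponential law call for derivatives that are again maps of a point and a
    direction. Hence the passage between [smooth_on] and [Csm] in both directions. Leaving
    [smooth_on] requires linearity of the derivative in its direction, which the definition does not
    contain; strictness provides it. Returning to [smooth_on] is done for maps into C^oo(M, E),
    whose derivatives arise directly as limits of difference quotients; the mean value theorem is
    applied only in spaces such as R^d, E and powers of E.

    Convergence in C^oo(M, E) is translated once and for all ([Cinfty_cvgP]) into continuous
    convergence of chart expressions and of their iterated tangent maps. One direction of this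
    translation rests on compactness alone and serves the exponential law, whose parameter space, G
    times C^oo(M, E), need not be locally compact. The other rests on local compactness of M and
    serves evaluation. *)

Lemma cvg_eq_near X (U : Type) (F : set_system X) (G : set_system U)
    (f g : X -> U) : Filter F ->
  (\forall k \near F, f k = g k) -> f @ F --> G -> g @ F --> G.
Proof. by move=> FF fg fG; apply: cvg_trans fG; exact: near_eq_cvg. Qed.

Section product_limits.
Context {X : Type} {U W : topologicalType} {F : set_system X} {FF : Filter F}.

Lemma cvg_fst_comp (f : X -> U * W) (a : U * W) :
  f @ F --> a -> (fun x => (f x).1) @ F --> a.1.
Proof. by move=> fa; apply: (cvg_comp _ fst fa); exact: cvg_fst. Qed.

Lemma cvg_snd_comp (f : X -> U * W) (a : U * W) :
  f @ F --> a -> (fun x => (f x).2) @ F --> a.2.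
Proof. by move=> fa; apply: (cvg_comp _ snd fa); exact: cvg_snd. Qed.

Lemma cvg_pair_nbhs (f : X -> U) (g : X -> W) (a : U) (b : W) :
  f @ F --> a -> g @ F --> b -> (fun x => (f x, g x)) @ F --> (a, b).
Proof. by move=> fa gb; exact: cvg_pair. Qed.

End product_limits.

Lemma nbhs_setX (U W : topologicalType) (x : U * W) (A : set U) (B : set W) :
  nbhs x.1 A -> nbhs x.2 B -> nbhs x (A `*` B).
Proof. by move=> nA nB; exists (A, B). Qed.

Lemma open_setX (U W : topologicalType) (A : set U) (B : set W) :
  open A -> open B -> open (A `*` B).
Proof.
move=> oA oB; rewrite openE => z [/= Az Bz].
by apply: nbhs_setX; exact: open_nbhs_nbhs.
Qed.

Section topological_vector_spaces.
Context {R : realType}.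
Implicit Types V W E : preTopologicalLmodType R.

(** A property rather than a bundled structure: for ['Cinfty(A, E)], which carries only a topology
    and a module structure, it is a theorem ([Cinfty_tvs_like]). *)
Record tvs_like V : Prop := TvsLike {
  tvs_addc : continuous (fun z : V * V => z.1 + z.2);
  tvs_scalec : continuous (fun z : R^o * V => z.1 *: z.2) }.

Lemma tvs_cvgD V X (F : set_system X) {FF : Filter F} (u v : X -> V) (a b : V) :
  tvs_like V -> u @ F --> a -> v @ F --> b ->
  (fun x => u x + v x) @ F --> a + b.
Proof.
by move=> hV ua vb; exact: (cvg_comp2 ua vb (@tvs_addc _ hV (a, b))).
Qed.

Lemma tvs_cvgZ V X (F : set_system X) {FF : Filter F} (t : X -> R) (v : X -> V)
  (a : R) (b : V) :
  tvs_like V -> t @ F --> a -> v @ F --> b ->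
  (fun x => t x *: v x) @ F --> a *: b.
Proof.
move=> hV ta vb.
exact: (cvg_comp2 (ta : (t : X -> R^o) @ F --> (a : R^o)) vb
  (@tvs_scalec _ hV (a, b))).
Qed.

Lemma tvs_cvgN V X (F : set_system X) {FF : Filter F} (v : X -> V) (b : V) :
  tvs_like V -> v @ F --> b -> (fun x => - v x) @ F --> - b.
Proof.
move=> hV vb; rewrite -scaleN1r.
have h := tvs_cvgZ (FF := FF) hV (@cvg_cst _ (-1 : R) _ F FF) vb.
apply: (cvg_trans _ h); apply: near_eq_cvg.
by apply: nearW => x; rewrite scaleN1r.
Qed.

Lemma tvs_cvgB V X (F : set_system X) {FF : Filter F} (u v : X -> V) (a b : V) :
  tvs_like V -> u @ F --> a -> v @ F --> b ->
  (fun x => u x - v x) @ F --> a - b.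
Proof. by move=> hV ua vb; exact: tvs_cvgD (tvs_cvgN _ vb). Qed.

Lemma tvs_cvg_line V X (F : set_system X) {FF : Filter F} (a b : X -> V)
  (t : X -> R) (x v : V) (s : R) :
  tvs_like V -> a @ F --> x -> b @ F --> v -> t @ F --> s ->
  (fun k => a k + t k *: b k) @ F --> x + s *: v.
Proof. by move=> hV ax bv ts; apply: tvs_cvgD => //; exact: tvs_cvgZ. Qed.

Lemma tvs_like_prod V W : tvs_like V -> tvs_like W -> tvs_like (V * W)%type.
Proof.
move=> hV hW; split=> z.
  have z1 := cvg_fst_comp (@cvg_id _ (nbhs z)).
  have z2 := cvg_snd_comp (@cvg_id _ (nbhs z)).
  apply: cvg_pair_nbhs; apply: tvs_cvgD => //.
  - exact: (cvg_fst_comp z1).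
  - exact: (cvg_fst_comp z2).
  - exact: (cvg_snd_comp z1).
  - exact: (cvg_snd_comp z2).
have z1 := cvg_fst_comp (@cvg_id _ (nbhs z)).
have z2 := cvg_snd_comp (@cvg_id _ (nbhs z)).
apply: cvg_pair_nbhs; apply: tvs_cvgZ => //.
  exact: (cvg_fst_comp z2).
exact: (cvg_snd_comp z2).
Qed.

Definition segment_convex V (S : set V) :=
  forall x y (t : R), S x -> S y -> 0 <= t <= 1 -> S (x + t *: (y - x)).

Lemma prod_hausdorff (U W : topologicalType) :
  hausdorff_space U -> hausdorff_space W -> hausdorff_space (U * W)%type.
Proof.
move=> hU hW [a b] [a' b'] h; congr (_, _).
  apply: hU => A B nA nB.
  have [||z [[/= ? _] [/= ? _]]] := h (A `*` setT) (B `*` setT);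
    last by exists z.1.
    by exists (A, setT) => //=; split => //; exact: filterT.
  by exists (B, setT) => //=; split => //; exact: filterT.
apply: hW => A B nA nB.
have [||z [[/= _ ?] [/= _ ?]]] := h (setT `*` A) (setT `*` B);
  last by exists z.2.
  by exists (setT, A) => //=; split => //; exact: filterT.
by exists (setT, B) => //=; split => //; exact: filterT.
Qed.

(** The convex neighbourhoods serve the mean value theorem: a mean slope lies in every open convex
    set that contains all the derivatives. *)
Record lcs W : Prop := Lcs {
  lcs_tvs : tvs_like W;
  lcs_hausdorff : hausdorff_space W;
  lcs_convex : forall (x : W) U, nbhs x U ->
    exists C : set W, [/\ open C, segment_convex C, C x & C `<=` U] }.

Lemma lcs_prod V W : lcs V -> lcs W -> lcs (V * W)%type.
Proof.
move=> hV hW; split.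
- exact: tvs_like_prod (lcs_tvs hV) (lcs_tvs hW).
- exact: prod_hausdorff (lcs_hausdorff hV) (lcs_hausdorff hW).
- move=> [x y] U [[A B] /= [nA nB] ABU].
  have [C [oC cC Cx CA]] := lcs_convex hV nA.
  have [D [oD cD Dy DB]] := lcs_convex hW nB.
  exists (C `*` D); split => //.
  + exact: open_setX.
  + move=> [a b] [a' b'] t [/= ? ?] [/= ? ?] t01; split => /=.
      exact: cC.
    exact: cD.
  + by move=> [a b] [/= Ca Db]; apply: ABU; split; [exact: CA|exact: DB].
Qed.

Lemma lcs_tvsType (E : tvsType R) : hausdorff_space E -> lcs E.
Proof.
move=> hE; split => //.
  by split; [exact: add_continuous|exact: scale_continuous].
move=> x U nU; have [B cB [oB bB]] := @locally_convex R E.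
have [C [BC Cx] CU] := bB x U nU.
exists C; split => //; first exact: oB.
move=> a b t Ca Cb /andP[t0 t1].
have := cB C (mem_set BC) b a (Itv01 t0 t1) (mem_set Cb) (mem_set Ca).
move=> /set_mem; congr (C _).
rewrite /conv /= scalerBr addrCA; congr (_ + _).
by rewrite /unstable.onem scalerBl scale1r.
Qed.

(* Such a D is contained in the closure of its interior, so that derivatives on
   D are unique and determined by their values on D°. *)
Definition fat V (D : set V) := tvs_like V /\
  exists O S e, [/\ open O, segment_convex S, S° e & D = O `&` S].

(** The homothety with centre [x] and ratio [s] maps [S] into itself by convexity, and a
    neighbourhood of [e] onto one of the point in question. Its inverse is [g]. *)
Lemma convex_interior V (S : set V) e x (s : R) :
  tvs_like V -> segment_convex S -> S° e -> S x -> 0 < s <= 1 ->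
  S° (x + s *: (e - x)).
Proof.
move=> hV cS Se Sx /andP[s0 s1].
pose g y := x + s^-1 *: (y - x).
have sn0 : s != 0 by rewrite gt_eqF.
have gc : g @ nbhs (x + s *: (e - x)) --> e.
  have ge : x + s^-1 *: (x + s *: (e - x) - x) = e.
    by rewrite (addrC x (s *: _)) addrK scalerA mulVf// scale1r addrC subrK.
  rewrite -[X in _ --> X]ge.
  apply: tvs_cvg_line => //; [exact: cvg_cst| |exact: cvg_cst].
  by apply: tvs_cvgB => //; exact: cvg_cst.
have := gc _ Se; rewrite /= nbhs_simpl /=.
apply: filterS => y /= Sg.
have -> : y = x + s *: (g y - x).
  by rewrite /g (addrC x (s^-1 *: _)) addrK scalerA mulfV// scale1r addrC subrK.
by apply: cS => //; rewrite ltW.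
Qed.

Lemma cvg_line0 V (x w : V) : tvs_like V ->
  (fun s : R => x + s *: w) @ (0 : R) --> x.
Proof.
move=> hV; rewrite -[X in _ --> X]addr0 -(scale0r w).
by apply: tvs_cvg_line => //; exact: cvg_cst.
Qed.

(** One point [e] serves all [x]. Convexity handles every [s] up to 1, but the open factor of [D]
    may be left, so [s] has to be small depending on [x]. *)
Lemma fat_approach V (D : set V) : fat D -> exists e, forall x, D x ->
  \forall s \near (0 : R)^'+, D° (x + s *: (e - x)).
Proof.
move=> [hV [Q [S [e [oQ cS Se ->]]]]]; exists e => x [Qx Sx].
rewrite interiorI; near=> s; split.
  rewrite (interior_id Q).1//; near: s.
  apply: cvg_within; apply: cvg_line0 => //.
  exact: open_nbhs_nbhs.
apply: convex_interior => //; apply/andP; split; near: s.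
  exact: nbhs_right_gt.
exact: nbhs_right_le.
Unshelve. all: by end_near. Qed.

Lemma open_fat V (D : set V) : tvs_like V -> open D -> fat D.
Proof.
move=> hV oD; split => //; exists D, setT, 0; split => //.
  by rewrite interiorT.
by rewrite setIT.
Qed.

Lemma fat_open_setI V (D O : set V) : open O -> fat D -> fat (D `&` O).
Proof.
move=> oO [hV [Q [S [e [oQ cS Se ->]]]]]; split => //.
by exists (Q `&` O), S, e; split => //; [exact: openI|rewrite setIAC].
Qed.

Lemma fat_setX V W (D : set V) (D' : set W) :
  fat D -> fat D' -> fat (D `*` D').
Proof.
move=> [hV [Q [S [e [oQ cS Se ->]]]]] [hW [Q' [S' [e' [oQ' cS' Se' ->]]]]].
split; first exact: tvs_like_prod.
exists (Q `*` Q'), (S `*` S'), (e, e'); split.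
- exact: open_setX.
- by move=> x y t [? ?] [? ?] ?; split; [exact: cS|exact: cS'].
- exact: nbhs_setX.
- by rewrite setXI.
Qed.

Lemma fat_setXT V W (D : set V) : tvs_like W -> fat D ->
  fat (D `*` [set: W]).
Proof.
move=> hW fD; apply: fat_setX => //; apply: open_fat => //; exact: openT.
Qed.

End topological_vector_spaces.

(** * Strict differentiability *)

Section strict_calculus.
Context {R : realType}.
Implicit Types V W E : preTopologicalLmodType R.

(* Continuity and differentiability quantify over arbitrary filters of base
   points and directions, so that they compose without product filters. *)
Definition cont_on V W (D : set V) (f : V -> W) :=
  forall (X : Type) (F : set_system X) (a : X -> V) (x : V), Filter F ->
    D x -> a @ F --> x -> (\forall k \near F, D (a k)) ->
    (fun k => f (a k)) @ F --> f x.

Definition quot V W (f : V -> W) (a v : V) (t : R) : W :=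
  t^-1 *: (f (a + t *: v) - f a).

(** Only the two ends of each increment have to lie in [D], not the segment between them, so that
    increments can be transported through arbitrary maps in the chain rule. *)
Definition strict_derive V W (D : set V) (f : V -> W) (x v : V) (l : W) :=
  forall (X : Type) (F : set_system X) (a b : X -> V) (t : X -> R), Filter F ->
    a @ F --> x -> b @ F --> v -> t @ F --> (0 : R) ->
    (\forall k \near F, [/\ D (a k), D (a k + t k *: b k) & t k != 0]) ->
    (fun k => quot f (a k) (b k) (t k)) @ F --> l.

(* C^n on D, the derivative being a map on D x V as in the tangent functor. *)
Fixpoint Cn (n : nat) V W (D : set V) (f : V -> W) : Prop :=
  cont_on D f /\
  if n is m.+1 then
    exists2 df : V * V -> W,
      forall x v, D x -> strict_derive D f x v (df (x, v)) & Cn m (D `*` setT)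
        df
  else True.

Definition Csm V W (D : set V) (f : V -> W) := forall n, Cn n D f.

Lemma cont_onP V W (D : set V) (f : V -> W) :
  cont_on D f <-> {within D, continuous f}.
Proof.
split=> [h|/subspace_continuousP h X F a x FF Dx ax Da].
  apply/subspace_continuousP => x Dx.
  apply: (h _ (within D (nbhs x)) id x) => //; first exact: cvg_within.
  exact: withinT.
apply: (cvg_comp _ f _ (h x Dx)) => U WU.
have : F (a @^-1` [set y | D y -> U y]) by apply: ax; exact: WU.
by apply: filterS2 Da => k Dk; apply.
Qed.

Lemma cont_on_within V W (D : set V) (f : V -> W) x : cont_on D f -> D x ->
  f @ within D (nbhs x) --> f x.
Proof. by move=> /cont_onP/subspace_continuousP; exact. Qed.

Lemma Cn_cont n V W (D : set V) (f : V -> W) : Cn n D f -> cont_on D f.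
Proof. by case: n => [[]|n []]. Qed.

Lemma cont_on_sub V W (D D' : set V) (f g : V -> W) :
  D' `<=` D -> (forall x, D' x -> f x = g x) -> cont_on D f -> cont_on D' g.
Proof.
move=> sD e h X F a x FF Dx ax Da; rewrite -e//.
have Da' : \forall k \near F, D (a k) by apply: filterS Da => k /sD.
have fx := h X F a x FF (sD _ Dx) ax Da'.
by apply: cvg_eq_near fx; apply: filterS Da => k /e.
Qed.

Lemma strict_sub V W (D D' : set V) (f g : V -> W) (x v : V) (l : W) :
  D' `<=` D -> (forall x, D' x -> f x = g x) -> strict_derive D f x v l ->
  strict_derive D' g x v l.
Proof.
move=> sD e h X F a b t FF ax bv t0 Dab.
have Dab' : \forall k \near F, [/\ D (a k), D (a k + t k *: b k) & t k != 0].
  by apply: filterS Dab => k [? ? ?]; split => //; exact: sD.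
apply: cvg_eq_near (h X F a b t FF ax bv t0 Dab').
by apply: filterS Dab => k [? ? ?]; rewrite /quot !e.
Qed.

Lemma Cn_sub n V W (D D' : set V) (f g : V -> W) :
  D' `<=` D -> (forall x, D' x -> f x = g x) -> Cn n D f -> Cn n D' g.
Proof.
elim: n V D D' f g => [|n IH] V D D' f g sD e [fc h].
  by split => //; exact: cont_on_sub fc.
split; first exact: cont_on_sub fc.
have [df hdf Cdf] := h; exists df.
  by move=> x v Dx; apply: strict_sub (hdf x v (sD _ Dx)).
by apply: IH Cdf => // p [/sD].
Qed.

Lemma CnW n V W (D : set V) (f : V -> W) : Cn n.+1 D f -> Cn n D f.
Proof.
elim: n V D f => [|n IH] V D f [fc [df hdf Cdf]]; first by split.
by split=> //; exists df => //; exact: IH.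
Qed.

Lemma Cn_lin n V W (D : set V) (f : V -> W) :
  (forall x v (t : R), f (x + t *: v) = f x + t *: f v) -> continuous f ->
  Cn n D f.
Proof.
elim: n V D f => [|n IH] V D f lf fc.
  split=> // X F a x FF Dx ax _; exact: (cvg_comp _ f ax (fc x)).
split.
  by move=> X F a x FF Dx ax _; exact: (cvg_comp _ f ax (fc x)).
exists (fun z => f z.2).
  move=> x v Dx X F a b t FF ax bv t0 Dab /=.
  apply: cvg_eq_near (cvg_comp _ f bv (fc v)).
  apply: filterS Dab => k [? ? tn0].
  by rewrite /quot lf (addrC (f _)) addrK scalerA mulVf// scale1r.
apply: IH => [x v t|x]; first exact: lf.
exact: (cvg_comp _ f (@cvg_snd _ _ (nbhs x.1) (nbhs x.2) _) (fc x.2)).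
Qed.

Lemma Cn_cst n V W (D : set V) (c : W) : tvs_like W -> Cn n D (fun=> c).
Proof.
move=> hW; elim: n V D c => [|n IH] V D c.
  by split=> // X F a x FF *; exact: cvg_cst.
split; first by move=> X F a x FF *; exact: cvg_cst.
exists (fun=> 0); last exact: IH.
move=> x v _ X F a b t FF ax bv t0 _.
rewrite [X in X @ _](_ : _ = fun=> 0); first exact: cvg_cst.
by apply/funext => k; rewrite /quot subrr scaler0.
Qed.

Lemma Cn_fst n V W (D : set (V * W)) : Cn n D fst.
Proof. by apply: Cn_lin => // x; exact: cvg_fst. Qed.

Lemma Cn_snd n V W (D : set (V * W)) : Cn n D snd.
Proof. by apply: Cn_lin => // x; exact: cvg_snd. Qed.

Lemma Cn_pair n V W E (D : set V) (f : V -> W) (g : V -> E) :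
  Cn n D f -> Cn n D g -> Cn n D (fun x => (f x, g x)).
Proof.
elim: n V D f g => [|n IH] V D f g [fc hf] [gc hg].
  split=> // X F a x FF Dx ax Da.
  by apply: cvg_pair_nbhs; [exact: fc|exact: gc].
split.
  move=> X F a x FF Dx ax Da.
  by apply: cvg_pair_nbhs; [exact: fc|exact: gc].
have [df hdf Cdf] := hf; have [dg hdg Cdg] := hg.
exists (fun z => (df z, dg z)); last exact: IH.
move=> x v Dx X F a b t FF ax bv t0 Dab /=.
apply: cvg_pair_nbhs; [exact: hdf|exact: hdg].
Qed.

(** The quotient of the composite is exactly the quotient of [g] at the base point [f a], with the
    quotient of [f] as direction and the same [t]. As directions may vary, no remainder term
    appears. *)
Lemma strict_comp V W E (D : set V) (D' : set W) (g : W -> E) (f : V -> W)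
    (x v : V) (l : W) (m : E) :
  cont_on D f -> (forall x, D x -> D' (f x)) -> D x ->
  strict_derive D f x v l -> strict_derive D' g (f x) l m ->
    strict_derive D (g \o f) x v m.
Proof.
move=> fc fD Dx hf hg X F a b t FF ax bv t0 Dab.
have Da : \forall k \near F, D (a k) by apply: filterS Dab => k [].
have Df k : t k != 0 ->
    f (a k) + t k *: quot f (a k) (b k) (t k) = f (a k + t k *: b k).
  by move=> tn0; rewrite /quot scalerA mulfV// scale1r addrC subrK.
have hg' := hg X F _ _ t FF (fc X F a x FF Dx ax Da)
  (hf X F a b t FF ax bv t0 Dab) t0.
have H : \forall k \near F, [/\ D' (f (a k)),
    D' (f (a k) + t k *: quot f (a k) (b k) (t k)) & t k != 0].
  by apply: filterS Dab => k [Dk Dk' tk]; split=> //; rewrite ?Df//; exact: fD.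
apply: cvg_eq_near (hg' H).
by apply: filterS Dab => k [_ _ tk]; rewrite {1}/quot Df.
Qed.

Lemma Cn_comp n V W E (D : set V) (D' : set W) (g : W -> E) (f : V -> W) :
  (forall x, D x -> D' (f x)) -> Cn n D' g -> Cn n D f ->
  Cn n D (fun x => g (f x)).
Proof.
have cc V' W' E' (D1 : set V') (D2 : set W') (h : W' -> E') (k : V' -> W') :
    (forall x, D1 x -> D2 (k x)) -> cont_on D2 h -> cont_on D1 k ->
    cont_on D1 (fun x => h (k x)).
  move=> kD hc kc X F a x FF Dx ax Da.
  apply: hc; [exact: kD|exact: kc|].
  by apply: filterS Da => i; exact: kD.
elim: n V W E D D' g f => [|n IH] V W E D D' g f fD [gc hg] [fc hf].
  by split=> //; exact: cc gc fc.
split; first exact: cc gc fc.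
have [df hdf Cdf] := hf; have [dg hdg Cdg] := hg.
exists (fun z => dg (f z.1, df z)).
  move=> x v Dx; apply: strict_comp (hdf _ _ Dx) (hdg _ _ _) => //; exact: fD.
apply: (IH _ _ _ _ (D' `*` setT) dg (fun z => (f z.1, df z))) => //.
  by move=> z [/fD].
apply: Cn_pair => //.
apply: (IH _ _ _ _ D f fst); [by move=> z [] | | exact: Cn_fst].
by apply: CnW; split.
Qed.

End strict_calculus.

Section derivatives.
Context {R : realType}.
Implicit Types V W E : preTopologicalLmodType R.

(** Strict derivatives are not vacuous, even at boundary points. The filter is an iterated limit:
    first [s] moves the base point into the interior, then [t] is taken so small, depending on [s],
    that the increment stays in [D]. *)
Lemma fat_strict_filter V (D : set V) (x v : V) : fat D -> D x ->
  exists (F : set_system (R * R)) (a : R * R -> V),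
    [/\ ProperFilter F, a @ F --> x, snd @ F --> (0 : R) &
        \forall k \near F, [/\ D (a k), D (a k + k.2 *: v) & k.2 != 0]].
Proof.
move=> fD Dx; have hV := fD.1; have [e De] := fat_approach fD.
pose F : set_system (R * R) := [set P |
  \forall s \near (0 : R)^'+, \forall t \near (0 : R)^', P (s, t)].
have FF : ProperFilter F.
  apply: Build_ProperFilter_ex.
    move=> P FP; have [s Fs] := @filter_ex _ (0 : R)^'+ _ _ FP.
    have [t Pst] := @filter_ex _ (0 : R)^' _ _ Fs.
    by exists (s, t).
  split.
  - by apply: nearW => s; exact: nearW.
  - move=> P Q; apply: (@filterS2 _ (0 : R)^'+) => s Ps Qs.
    by apply: filterS2 Ps Qs => t; split.
  - move=> P Q PQ; apply: (@filterS _ (0 : R)^'+) => s.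
    by apply: filterS => t /PQ.
exists F, (fun k => x + k.1 *: (e - x)); split => //.
- move=> U nU.
  have : (fun s : R => x + s *: (e - x)) @ (0 : R)^'+ --> x.
    apply: cvg_within_filter; exact: cvg_line0.
  move=> /(_ _ nU); apply: (@filterS _ (0 : R)^'+) => s Us.
  exact: nearW.
- move=> U nU.
  by apply: (nearW (F := (0 : R)^'+)) => s; exact: cvg_within.
- have := De x Dx; apply: (@filterS _ (0 : R)^'+) => s Ds.
  near=> t; split => //=.
  + exact: interior_subset.
  + near: t; apply: cvg_within.
    exact: (@cvg_line0 _ _ (x + s *: (e - x)) v hV _ Ds).
  + near: t; exact: nbhs_dnbhs_neq.
Unshelve. all: by end_near. Qed.

Lemma strict_unique V W (D : set V) (f : V -> W) (x v : V) (l m : W) :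
  hausdorff_space W -> fat D -> D x ->
  strict_derive D f x v l -> strict_derive D f x v m -> l = m.
Proof.
move=> hW fD Dx hl hm.
have [F [a [FF ax t0 Dk]]] := fat_strict_filter v fD Dx.
apply: (@cvg_unique _ hW (fmap (fun k => quot f (a k) v k.2) F)).
  by apply: hl => //; exact: cvg_cst.
by apply: hm => //; exact: cvg_cst.
Qed.

Lemma near_line_interior V (D : set V) (x v : V) : tvs_like V -> D° x ->
  \forall h \near (0 : R), D (x + h *: v).
Proof. by move=> hV Dx; exact: (@cvg_line0 _ _ x v hV _ Dx). Qed.

Lemma strict_line V W (D : set V) (f : V -> W) (x v : V) (l : W) :
  tvs_like V -> D° x -> strict_derive D f x v l ->
  (fun h : R => h^-1 *: (f (x + h *: v) - f x)) @ (0 : R)^' --> l.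
Proof.
move=> hV Dx hl; apply: (hl _ _ (fun=> x) (fun=> v) id).
- exact: cvg_cst.
- exact: cvg_cst.
- exact: cvg_within.
- near=> h; split.
  + exact: interior_subset.
  + by near: h; apply: cvg_within; exact: near_line_interior.
  + near: h; exact: nbhs_dnbhs_neq.
Unshelve. all: by end_near. Qed.

Lemma dir_deriveE V W (f : V -> W) (x v : V) (l : W) : hausdorff_space W ->
  (fun h : R => h^-1 *: (f (x + h *: v) - f x)) @ (0 : R)^' --> l ->
  dir_derive f x v = l.
Proof.
move=> hW hl; rewrite /dir_derive; apply: xget_unique => // m hm.
exact: (cvg_unique hW hm hl).
Qed.

Lemma fat_within_interior V (D : set V) (x : V) : fat D -> D x ->
  ProperFilter (within D° (nbhs x)).
Proof.
move=> fD Dx; have [e De] := fat_approach fD.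
have h : (fun s : R => x + s *: (e - x)) @ (0 : R)^'+ --> x.
  by apply: cvg_within_filter; exact: cvg_line0 fD.1.
apply: Build_ProperFilter_ex => P; rewrite /within /= => wP.
have [s [? ?]] : exists s : R, D° (x + s *: (e - x)) /\
    (D° (x + s *: (e - x)) -> P (x + s *: (e - x))).
  apply: (@filter_ex _ (0 : R)^'+); near=> s; split; near: s; first exact: De.
  exact: (h _ wP).
by exists (x + s *: (e - x)); tauto.
Unshelve. all: by end_near. Qed.

Definition has_derivative V W (D : set V) (f : V -> W) (df : V * V -> W) :=
  forall x v, D x -> strict_derive D f x v (df (x, v)).

(** On the interior the directional derivative is [df], and [df] is continuous up to the boundary.
    This ties the strict calculus to the derivative that defines tangent maps. *)
Lemma derive_withinE V W (D : set V) (f : V -> W) (df : V * V -> W) (x v : V) :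
  hausdorff_space W -> fat D -> has_derivative D f df ->
  cont_on (D `*` setT) df -> D x -> derive_within D f x v = df (x, v).
Proof.
move=> hW fD hdf cdf Dx; rewrite /derive_within.
have wP := fat_within_interior fD Dx.
have h : dir_derive f y v @[y --> within D° (nbhs x)] --> df (x, v).
  have : (fun y => df (y, v)) @ within D° (nbhs x) --> df (x, v).
    apply: cdf => //.
      by apply: cvg_pair_nbhs; [exact: cvg_within|exact: cvg_cst].
    near=> y; split => //=; apply: interior_subset.
    by near: y; exact: withinT.
  apply: cvg_eq_near; near=> y; apply/esym/dir_deriveE => //.
  have Dy : D° y by near: y; exact: withinT.
  apply: (strict_line fD.1 Dy); apply: hdf; exact: interior_subset.
apply: xget_unique => // m hm; exact: (cvg_unique hW hm h).
Unshelve. all: by end_near. Qed.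

Definition dmap V W (D : set V) (f : V -> W) : V * V -> W :=
  fun p => derive_within D f p.1 p.2.

(** The tangent map in local coordinates: the changes of charts of [tangent_atlas] and the chart
    expressions of [tangent_map] all have this form. *)
Definition locT V W (D : set V) (f : V -> W) : V * V -> W * W :=
  fun p => (f p.1, derive_within D f p.1 p.2).

(** The hypothesis gives a derivative for each order separately. Uniqueness identifies all of them
    with the canonical one on [D], so that a single map is of every class. *)
Lemma Csm_dmap V W (D : set V) (f : V -> W) :
  hausdorff_space W -> fat D -> Csm D f ->
  has_derivative D f (dmap D f) /\ Csm (D `*` setT) (dmap D f).
Proof.
move=> hW fD sf.
have dE n (df : V * V -> W) : has_derivative D f df -> Cn n (D `*` setT) df ->
    forall p, (D `*` setT) p -> df p = dmap D f p.
  move=> hdf /Cn_cont cdf [x v] [/= Dx _]; apply/esym.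
  exact: (derive_withinE v hW fD hdf cdf Dx).
split.
  have [_ [df hdf Cdf]] := sf 1%N.
  by move=> x v Dx; rewrite -(dE 0%N _ hdf Cdf)//; exact: hdf.
move=> n; have [_ [df hdf Cdf]] := sf n.+1.
exact: Cn_sub (dE _ _ hdf Cdf) Cdf.
Qed.

Lemma dmapE V W (D : set V) (f : V -> W) df (x v : V) :
  hausdorff_space W -> fat D -> Csm D f -> D x ->
  strict_derive D f x v df -> derive_within D f x v = df.
Proof.
move=> hW fD sf Dx h; have [hd _] := Csm_dmap hW fD sf.
exact: strict_unique (hd x v Dx) h.
Qed.

Lemma Csm_comp V W E (D : set V) (D' : set W) (g : W -> E) (f : V -> W) :
  (forall x, D x -> D' (f x)) -> Csm D' g -> Csm D f -> Csm D (fun x =>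
    g (f x)).
Proof. by move=> fD sg sf n; apply: Cn_comp fD _ _. Qed.

Lemma Csm_locT V W (D : set V) (f : V -> W) :
  hausdorff_space W -> fat D -> Csm D f -> Csm (D `*` setT) (locT D f).
Proof.
move=> hW fD sf n; apply: Cn_pair; last exact: (Csm_dmap hW fD sf).2.
by apply: (Cn_comp (D' := D)) => [[x v] [] //|//|]; exact: Cn_fst.
Qed.

Lemma locT_eq V W (D : set V) (f g : V -> W) p : hausdorff_space W -> fat D ->
  Csm D f -> (forall x, D x -> f x = g x) -> D p.1 -> locT D f p = locT D g p.
Proof.
move=> hW fD sf e Dp; rewrite /locT /= e//; congr (_, _); apply: esym.
apply: dmapE => //; first by move=> n; exact: Cn_sub (sf n).
apply: (strict_sub (f := f) (D := D)) => //.
exact: (Csm_dmap hW fD sf).1 _ _ Dp.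
Qed.

Lemma strict_local V W (D N : set V) (f : V -> W) (x v : V) (l : W) :
  tvs_like V -> open N -> N x ->
  strict_derive (D `&` N) f x v l -> strict_derive D f x v l.
Proof.
move=> hV oN Nx h X F a b t FF ax bv t0 Dab; apply: h => //.
have nN : nbhs x N by exact: open_nbhs_nbhs.
have Na : \forall k \near F, N (a k) by exact: ax.
have abx : (fun k => a k + t k *: b k) @ F --> x.
  by rewrite -[X in _ --> X]addr0 -(scale0r v); exact: tvs_cvg_line.
have Nab : \forall k \near F, N (a k + t k *: b k) by exact: abx.
by apply: filterS3 Na Nab Dab => k ? ? [? ? ?]; split => //; split.
Qed.

(** Local derivatives are chosen point by point and glued by taking, at each base point, the one
    chosen there. By uniqueness this agrees near each point with one fixed local derivative and so
    inherits its class. *)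
Lemma Cn_local n V W (D : set V) (f : V -> W) :
  hausdorff_space W -> fat D ->
  (forall x, D x -> exists N, [/\ open N, N x & Cn n (D `&` N) f]) ->
  Cn n D f.
Proof.
move=> hW; elim: n V D f => [|n IH] V D f fD loc.
  split=> // X F a x FF Dx ax Da; have [N [oN Nx [fc _]]] := loc x Dx.
  have Na : \forall k \near F, N (a k) by apply: ax; exact: open_nbhs_nbhs.
  by apply: fc => //; apply: filterS2 Da Na => k Dk Nk; split.
have hV := fD.1.
split.
  move=> X F a x FF Dx ax Da; have [N [oN Nx [fc _]]] := loc x Dx.
  have Na : \forall k \near F, N (a k) by apply: ax; exact: open_nbhs_nbhs.
  by apply: fc => //; apply: filterS2 Da Na => k Dk Nk; split.
have /choice[dN hdN] : forall x, exists dN : (V * V -> W) * set V, D x ->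
    [/\ open dN.2, dN.2 x, has_derivative (D `&` dN.2) f dN.1 &
     Cn n ((D `&` dN.2) `*` setT) dN.1].
  move=> x; have [Dx|nDx] := pselect (D x); last by exists (fun=> 0, setT).
  by have [N [oN Nx [_ [df hdf Cdf]]]] := loc x Dx; exists (df, N).
pose df z := (dN z.1).1 z.
have hdf : has_derivative D f df.
  move=> x v Dx; have [oN Nx hx _] := hdN x Dx.
  by apply: (strict_local hV oN Nx); exact: hx.
exists df => //; apply: IH; first exact: fat_setXT.
move=> [x v] [/= Dx _]; have [oN Nx hx Cx] := hdN x Dx.
exists ((dN x).2 `*` setT); split => //; first exact: open_setX openT.
apply: Cn_sub Cx.
  by move=> z [[/= ? _] [/= ? _]]; split.
move=> [y w] [[/= Dy _] [/= Ny _]].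
apply: (strict_unique (f := f) (v := w) hW fD Dy); last exact: hdf.
by apply: (strict_local hV oN Ny); exact: hx.
Qed.

Lemma Csm_local V W (D : set V) (f : V -> W) :
  hausdorff_space W -> fat D ->
  (forall x, D x -> exists N, [/\ open N, N x & Csm (D `&` N) f]) -> Csm D f.
Proof.
move=> hW fD loc n; apply: Cn_local => // x Dx.
by have [N [oN Nx sf]] := loc x Dx; exists N.
Qed.

End derivatives.

(** * The mean value theorem *)

Section mean_value.
Context {R : realType}.
Implicit Types V W E : preTopologicalLmodType R.

Lemma near0_abs (P : R -> Prop) : (\forall h \near (0 : R), P h) ->
  exists2 e : R, 0 < e & forall h, `|h| < e -> P h.
Proof.
move=> /nbhs_ballP[e e0 eP]; exists e => // h he; apply: eP.
by rewrite -ball_normE /= sub0r normrN.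
Qed.

(* By convexity the conclusion passes from r to s > r if it holds for the step
   from r to s, so it cannot start to fail at the infimum of the failing s. *)
Lemma mean_value W (C : set W) (g dg : R -> W) : open C -> segment_convex C ->
  (forall s : R, 0 <= s <= 1 ->
    (fun h => h^-1 *: (g (s + h) - g s)) @ (0 : R)^' --> dg s /\ C (dg s)) ->
  C (g 1 - g 0).
Proof.
move=> oC cC gP.
have near_s (s : R) : 0 <= s <= 1 -> exists2 e : R, 0 < e &
    forall h, `|h| < e -> h != 0 -> C (h^-1 *: (g (s + h) - g s)).
  move=> /gP[gs Cs]; apply: near0_abs.
  exact: (gs _ (open_nbhs_nbhs (conj oC Cs))).
(* The slope over [0, s] is the convex combination of the slopes over [0, r] and [r, s], with weight
   (s - r) / s on the second. *)
have glue (r s : R) : 0 < r -> r < s -> C (r^-1 *: (g r - g 0)) ->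
    C ((s - r)^-1 *: (g s - g r)) -> C (s^-1 *: (g s - g 0)).
  move=> r0 rs C1 C2.
  have s0 : 0 < s by exact: lt_trans rs.
  have rs01 : 0 <= (s - r) / s <= 1.
    apply/andP; split; first by apply: divr_ge0; rewrite ?subr_ge0 ltW.
    by rewrite ler_pdivrMr// mul1r lerBlDr lerDl ltW.
  have := cC _ _ _ C1 C2 rs01; congr C.
  have -> : g s - g 0 = (g r - g 0) + (g s - g r)
    by rewrite [RHS]addrC addrA subrK.
  move: (g r - g 0) (g s - g r) => p q; rewrite scalerBr !scalerA.
  have -> : (s - r) / s / r = r^-1 - s^-1.
    by rewrite mulrBl mulfV ?gt_eqF// mulrBl mul1r mulrAC mulfV ?mul1r ?gt_eqF.
  have -> : (s - r) / s * (s - r)^-1 = s^-1.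
    by rewrite mulrAC mulfV ?mul1r// gt_eqF// subr_gt0.
  by rewrite scalerBl opprB addrCA [X in _ + X]addrC subrK scalerDr addrC.
apply: contrapT => nC1.
pose B := [set s : R | 0 < s <= 1 /\ ~ C (s^-1 *: (g s - g 0))].
have B1 : B 1 by split; [rewrite ltr01 lexx|rewrite invr1 scale1r].
have hB : has_inf B.
  by split; [exists 1|exists 0 => s [/andP[/ltW]]].
have [e0 e00 g0P] : exists2 e : R, 0 < e & forall h, `|h| < e -> h != 0 ->
    C (h^-1 *: (g (0 + h) - g 0)) by apply: near_s; rewrite lexx ler01.
pose b := inf B.
have b_gt0 : 0 < b.
  apply: lt_le_trans e00 _; apply: lb_le_inf; first by exists 1.
  move=> s [/andP[s0 _]]; apply: contra_not_le => se.
  by have := g0P s; rewrite add0r gtr0_norm// gt_eqF//; apply.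
have b_le1 : b <= 1 by apply: ge_inf => //; exact: hB.2.
have [e e_gt0 gbP] := near_s b (introT andP (conj (ltW b_gt0) b_le1)).
have below (r : R) : 0 < r -> r < b -> C (r^-1 *: (g r - g 0)).
  move=> r0 rb; apply: contrapT => nC.
  suff : b <= r by rewrite leNgt rb.
  apply: ge_inf; first exact: hB.2.
  by split=> //; rewrite r0/= (le_trans (ltW rb)).
(* The infimum itself is not a failure: b - h lies below it, and the step from b - h to [b] is
   controlled by the derivative at [b]. The bound b / 2 keeps b - h positive, e / 2 keeps the step
   within reach of [gbP]. *)
have Cb : C (b^-1 *: (g b - g 0)).
  pose h := Num.min (b / 2) (e / 2).
  have h0 : 0 < h by rewrite lt_min !divr_gt0.
  have hb : h < b.
    by rewrite (le_lt_trans (_ : h <= b / 2))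
      ?ge_min ?lexx// ltr_pdivrMr// ltr_pMr// ltr1n.
  have he : h < e.
    by rewrite (le_lt_trans (_ : h <= e / 2))
      ?ge_min ?lexx ?orbT// ltr_pdivrMr// ltr_pMr// ltr1n.
  apply: (glue (b - h)).
  - by rewrite subr_gt0.
  - by rewrite ltrBlDr ltrDl.
  - by apply: below; rewrite ?subr_gt0// ltrBlDr ltrDl.
  - have := gbP (- h); rewrite normrN gtr0_norm// oppr_eq0 gt_eqF// =>
      /(_ he isT).
    by congr C; rewrite subKr invrN scaleNr -scalerN opprB.
(* A failing [s] closer to [b] than [e] is refuted by gluing the slope over [0, b] to the one over
   [b, s]. *)
have [s [s01 nCs] sbe] := inf_adherent e_gt0 hB.
have bs : b <= s by apply: ge_inf => //; exact: hB.2.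
move: bs; rewrite le_eqVlt => /predU1P[bs|bs]; first by rewrite -bs in nCs.
apply: nCs; apply: (glue b) => //.
have := gbP (s - b); rewrite gtr0_norm ?subr_gt0// ltrBlDl subr_eq0 gt_eqF//.
by move=> /(_ sbe isT); rewrite [b + _]addrC subrK.
Qed.

Lemma dnbhs0_scale (t : R) : t != 0 -> (fun h => t * h) @ (0 : R)^' -->
  (0 : R)^'.
Proof.
move=> t0 P [e e0 eP]; exists (e / `|t|); first by rewrite /=
  divr_gt0// normr_gt0.
move=> h /=; rewrite sub0r normrN ltr_pdivlMr ?normr_gt0// => he h0.
apply: eP; last by rewrite mulf_neq0.
by rewrite /= sub0r normrN normrM mulrC.
Qed.

(** With the factor [t^-1] in front, the curve s -> f (x + (s t) v) / t has the directional
    derivative along [v] as its derivative, free of [t], and its increment over [0, 1] is the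
    difference quotient. *)
Lemma gateaux_reparam V W (f : V -> W) (x v : V) (l : W) (t s : R) : t != 0 ->
  (fun h : R => h^-1 *: (f (x + (s * t) *: v + h *: v) - f (x + (s * t) *: v)))
    @ (0 : R)^' --> l ->
  (fun h : R => h^-1 *: (t^-1 *: f (x + ((s + h) * t) *: v)
     - t^-1 *: f (x + (s * t) *: v))) @ (0 : R)^' --> l.
Proof.
move=> t0 hl; have := cvg_comp _ _ (dnbhs0_scale t0) hl.
apply: cvg_eq_near; near=> h.
rewrite /= -scalerBr scalerA invfM [t^-1 * _]mulrC; congr (_ *: (f _ - _)).
by rewrite mulrDl scalerDl addrA [h * t]mulrC.
Unshelve. all: by end_near. Qed.

Lemma segment_quot V W (D : set V) (f : V -> W) df (x v : V) (t : R) C :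
  t != 0 -> open C -> segment_convex C ->
  (forall x v, D° x ->
    (fun h : R => h^-1 *: (f (x + h *: v) - f x)) @ (0 : R)^' --> df (x, v)) ->
  (forall s : R, 0 <= s <= 1 -> D° (x + (s * t) *: v) /\
    C (df (x + (s * t) *: v, v))) ->
  C (quot f x v t).
Proof.
move=> t0 oC cC hf h.
have : C (t^-1 *: f (x + (1 * t) *: v) - t^-1 *: f (x + (0 * t) *: v)).
  apply: (mean_value (g := fun s => t^-1 *: f (x + (s * t) *: v))
    (dg := fun s => df (x + (s * t) *: v, v))) => // s s01.
  by have [Ds Cs] := h s s01; split => //; apply: gateaux_reparam => //;
    exact: hf.
by rewrite /quot mul1r mul0r scale0r addr0 scalerBr.
Qed.

(* Every segment in D can be pushed into D° by moving both ends slightly towards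
   an interior point of the convex set S; there the mean value theorem bounds the
   difference quotient by the values of df. *)
Lemma gateaux_strict V W (D : set V) (f : V -> W) (df : V * V -> W) :
  fat D -> lcs W -> cont_on D f -> cont_on (D `*` setT) df ->
  (forall x v, D° x ->
    (fun h : R => h^-1 *: (f (x + h *: v) - f x)) @ (0 : R)^' --> df (x, v)) ->
  has_derivative D f df.
Proof.
move=> fD lW fc dfc hf x v Dx X F a b t FF ax bv t0 Dab U nU.
have hW := lcs_tvs lW; have [hV [Q [S [e [oQ cS Se DE]]]]] := fD.
(* [A] will contain the quotient of the pushed segment, by the mean value theorem; [N] will contain
   its difference from the original quotient, which tends to 0 as the push does. *)
have [A [N [nA nN AN]]] : exists A N : set W, [/\ nbhs (df (x, v)) A, nbhs 0 N &
    forall y z, A y -> N z -> U (y + z)].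
  have := @tvs_addc _ _ hW (df (x, v), 0) U; rewrite /= addr0 => /(_ nU).
  by move=> [[A N] /= [nA nN] AN]; exists A, N; split => // y z ? ?;
    exact: (AN (y, z)).
have [C [oC cC Cl CA]] := lcs_convex lW nA.
have [P [Q' [nP nQ' PQ]]] : exists (P : set V) (Q' : set V),
    [/\ nbhs x P, nbhs v Q' &
     forall y w, P y -> Q' w -> D y -> C (df (y, w))].
  have : within (D `*` setT) (nbhs (x, v)) (df @^-1` C).
    have nC : nbhs (df (x, v)) C by exact: open_nbhs_nbhs.
    apply: (dfc _ (within (D `*` setT) (nbhs (x, v))) id (x, v) _ _ _ _ _ nC) =>
      //.
      exact: cvg_within.
    exact: withinT.
  move=> [[P Q'] /= [nP nQ'] h]; exists P, Q'; split => // y w Py Qw Dy.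
  by apply: (h (y, w)).
have : (fun p : V * V * R => p.1.1 + p.2 *: p.1.2) @ nbhs (x, v, 0 : R) --> x.
  rewrite -[X in _ --> X]addr0 -(scale0r v).
  have p1 := cvg_fst_comp (@cvg_id _ (nbhs (x, v, 0 : R))).
  apply: tvs_cvg_line => //.
  - exact: (cvg_fst_comp p1).
  - exact: (cvg_snd_comp p1).
  - exact: (cvg_snd_comp (@cvg_id _ (nbhs (x, v, 0 : R)))).
have Qx : Q x by move: Dx; rewrite DE => -[].
have nPQ : nbhs x (P `&` Q) by apply: filterI => //; exact: open_nbhs_nbhs.
move=> /(_ _ nPQ)[[PV T] /= [[[P1 V1] /=
  [nP1 nV1] PVs] /near0_abs[d d0 dT]] line].
have seg y w (r : R) : P1 y -> V1 w -> `|r| < d -> (P `&` Q) (y + r *: w).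
  by move=> Py Vw rd; apply: (line (y, w, r)); split; [exact: (PVs (y,
    w))|exact: dT].
have nearF : \forall k \near F, [/\ P1° (a k), (V1 `&` Q')° (b k) & `|t k| < d].
  have Pa : \forall k \near F, P1° (a k) by apply: ax; exact: nbhs_interior.
  have Vb : \forall k \near F, (V1 `&` Q')° (b k).
    by apply: bv; apply: nbhs_interior; exact: filterI.
  have td : \forall r \near (0 : R), `|r| < d.
    by apply/nbhs_ballP; exists d => // r; rewrite -ball_normE /= sub0r normrN.
  have tF : \forall k \near F, `|t k| < d by exact: (t0 _ td).
  by apply: filterS3 Pa Vb tF.
apply: filterS2 nearF Dab => k [Pa Vb tk] [Da Dab tn0] /=.
set y := a k in Pa Da Dab *; set w := b k in Vb Dab *; set r :=
  t k in tk tn0 Dab *.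
(* Moving both ends of the segment from [y] to y + r w towards [e] by the ratio [s] multiplies the
   direction by 1 - s; hence [we]. *)
pose ye (s : R) := y + s *: (e - y); pose we (s : R) := w + s *: (- w).
have yec : ye @ (0 : R)^'+ --> y by apply: cvg_within_filter; exact: cvg_line0.
have wec : we @ (0 : R)^'+ --> w by apply: cvg_within_filter; exact: cvg_line0.
have [Qy Sy] : Q y /\ S y by move: Da; rewrite DE.
have [Qyw Syw] : Q (y + r *: w) /\ S (y + r *: w) by move: Dab; rewrite DE.
have point s (z : R) : ye s + (z * r) *: we s =
    (y + z *: ((y + r *: w) - y)) + s *: (e - (y + z *: ((y + r *: w) - y))).
  rewrite /ye /we [y + r *: w - y]addrAC subrr add0r scalerA.
  have -> : (z * r) *: (w + s *: (- w)) =
      (z * r) *: w + s *: (- ((z * r) *: w)).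
    by rewrite scalerDr !scalerN !scalerA [s * _]mulrC.
  by rewrite opprD (addrA e) [s *: (e - y - _)]scalerDr addrACA.
have S_int s (z : R) : 0 < s <= 1 -> 0 <= z <= 1 -> S° (ye s + (z * r) *: we s).
  by move=> s01 z01; rewrite point; apply: convex_interior => //; exact: cS.
have in01 : \forall s \near (0 : R)^'+, 0 < s <= 1.
  by near=> s; apply/andP; split; near: s;
    [exact: nbhs_right_gt|exact: nbhs_right_le].
have nPy : \forall s \near (0 : R)^'+, P1 (ye s) by exact: (yec _ Pa).
have nVw : \forall s \near (0 : R)^'+, (V1 `&` Q') (we s) by exact: (wec _ Vb).
have zr (z : R) : 0 <= z <= 1 -> `|z * r| < d.
  move=> /andP[z0 z1]; rewrite normrM ger0_norm// (le_lt_trans _ tk)//.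
  by rewrite ler_piMl.
have inD s z : 0 < s <= 1 -> P1 (ye s) -> (V1 `&` Q') (we s) -> 0 <= z <= 1 ->
    P (ye s + (z * r) *: we s) /\ D° (ye s + (z * r) *: we s).
  move=> s01 Ps [Vs _] z01; have [Pz Qz] := seg _ _ _ Ps Vs (zr z z01).
  split => //; rewrite DE interiorI; split; last exact: S_int.
  by rewrite (interior_id Q).1.
have Cs : \forall s \near (0 : R)^'+, C (quot f (ye s) (we s) r).
  near=> s.
  have s01 : 0 < s <= 1 by near: s.
  have Ps : P1 (ye s) by near: s.
  have Vs : (V1 `&` Q') (we s) by near: s.
  apply: (segment_quot tn0 oC cC hf) => z z01.
  have [Pz Dz] := inD s z s01 Ps Vs z01; split => //.
  by apply: PQ => //; [case: Vs|exact: interior_subset].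
(* Here the index [k] is fixed and only the push tends to 0, so continuity of [f] on [D] at the two
   ends is enough. *)
have qc : (fun s => quot f (ye s) (we s) r) @ (0 : R)^'+ --> quot f y w r.
  apply: tvs_cvgZ => //; first exact: cvg_cst.
  apply: tvs_cvgB => //; apply: fc => //.
  - by apply: tvs_cvg_line => //; exact: cvg_cst.
  - near=> s; rewrite -[r]mul1r; apply: interior_subset.
    apply: (inD s 1 _ _ _ _).2; [by near: s|by near: s|by near: s|].
    by rewrite ler01 lexx.
  - near=> s.
    suff : D° (ye s + (0 * r) *: we s).
      by rewrite mul0r scale0r addr0; exact: interior_subset.
    apply: (inD s 0 _ _ _ _).2; [by near: s|by near: s|by near: s|].
    by rewrite ler01 lexx.
have : (fun s => quot f y w r - quot f (ye s) (we s) r) @ (0 : R)^'+ -->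
  (0 : W).
  by rewrite -(subrr (quot f y w r)); apply: tvs_cvgB => //; exact: cvg_cst.
move=> /(_ _ nN) Nq.
have [s [Csq Nsq]] : exists s, C (quot f (ye s) (we s) r) /\
    N (quot f y w r - quot f (ye s) (we s) r).
  by apply: (@filter_ex _ (0 : R)^'+); apply: filterS2 Cs Nq.
have := AN _ _ (CA _ Csq) Nsq.
by rewrite addrC subrK.
Unshelve. all: by end_near. Qed.

End mean_value.

(** * Symmetry of second derivatives *)

Section second_derivative.
Context {R : realType}.
Implicit Types V W E : preTopologicalLmodType R.

(** For fixed small [t] the expression is the increment over [0, 1] of the curve [g] below. Its
    derivative at [s] is a difference quotient of [df] in direction (w, 0), based at the moving
    point x + (s t) v. Strictness of [ddf] controls these quotients uniformly in the base point, and
    the mean value theorem applies. *)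
Lemma second_difference V W (D : set V) (f : V -> W) (df : V * V -> W)
    (ddf : (V * V) * (V * V) -> W) (x v w : V) :
  tvs_like V -> lcs W -> has_derivative D f df ->
  has_derivative (D `*` setT) df ddf -> D° x ->
  (fun t : R => (t^-1 * t^-1) *:
     (f (x + t *: v + t *: w) - f (x + t *: v) - (f (x + t *: w) - f x)))
    @ (0 : R)^' --> ddf ((x, v), (w, 0)).
Proof.
move=> hV lW hf hdf Dx U nU.
have [C [oC cC Cl CU]] := lcs_convex lW nU.
pose G : set_system (V * R) :=
  within [set k | [/\ D k.1, D (k.1 + k.2 *: w) & k.2 != 0]] (nbhs (x, 0 : R)).
have near_C : nbhs (x, 0 : R) [set k | D k.1 -> D (k.1 + k.2 *: w) ->
    k.2 != 0 -> C (k.2^-1 *: (df (k.1 + k.2 *: w, v) - df (k.1, v)))].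
  have k1 := cvg_fst_comp (@cvg_id _ (nbhs (x, 0 : R))).
  have k2 := cvg_snd_comp (@cvg_id _ (nbhs (x, 0 : R))).
  have : (fun k => quot df (k.1, v) (w, 0) k.2) @ G --> ddf ((x, v), (w, 0)).
    apply: hdf => //.
    - by split => //; exact: interior_subset.
    - by apply: cvg_pair_nbhs; [apply: cvg_within_filter;
        exact: k1|exact: cvg_cst].
    - exact: cvg_cst.
    - by apply: cvg_within_filter; exact: k2.
    - by apply: filterS (withinT _ _) => k [? ? ?]; split.
  move=> /(_ _ (open_nbhs_nbhs (conj oC Cl))).
  rewrite /G /within /= => GC.
  apply: (@filterS _ (nbhs (x, 0 : R)) _ _ _ _ GC) => k h Dk Dkw k0.
  have e : (k.1, v) + k.2 *: (w, 0) = (k.1 + k.2 *: w, v) :> V * V.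
    by congr (_, _); rewrite /= scaler0 addr0.
  by have : C (quot df (k.1, v) (w, 0) k.2) := h (And3 Dk Dkw k0);
    rewrite /quot e.
have line2 : (fun p : R * R => x + p.1 *: v + p.2 *: w) @ nbhs (0 : R, 0 : R)
  --> x.
  rewrite -[X in _ --> X]addr0 -(scale0r w) -[X in X + _]addr0 -(scale0r v).
  apply: tvs_cvg_line => //.
  - apply: tvs_cvg_line => //; [exact: cvg_cst|exact: cvg_cst|].
    exact: (cvg_fst_comp (@cvg_id _ (nbhs (0 : R, 0 : R)))).
  - exact: cvg_cst.
  - exact: (cvg_snd_comp (@cvg_id _ (nbhs (0 : R, 0 : R)))).
have [[N T] /= [nN nT] NT] := near_C.
have nDN : nbhs x (D° `&` N).
  by apply: filterI => //; exact: nbhs_interior.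
have [[S1 S2] /= [/near0_abs[d1 d10 dS1] /near0_abs[d2 d20 dS2]] S12] :=
  line2 _ nDN.
have [d3 d30 dT] := near0_abs nT.
suff : \forall t \near (0 : R)^', C ((t^-1 * t^-1) *:
    (f (x + t *: v + t *: w) - f (x + t *: v) - (f (x + t *: w) - f x))).
  by apply: filterS => t /CU.
have nd (d : R) : 0 < d -> \forall t \near (0 : R)^', `|t| < d.
  move=> d0; apply: cvg_within; apply/nbhs_ballP; exists d => // r.
  by rewrite -ball_normE /= sub0r normrN.
near=> t.
have t1 : `|t| < d1 by near: t; exact: nd.
have t2 : `|t| < d2 by near: t; exact: nd.
have t3 : `|t| < d3 by near: t; exact: nd.
have t0 : t != 0 by near: t; exact: nbhs_dnbhs_neq.
have inDN (s : R) : 0 <= s <= 1 -> (D° `&` N) (x + (s * t) *: v) /\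
    D° (x + (s * t) *: v + t *: w).
  move=> /andP[s0 s1].
  have st : `|s * t| < d1.
    by rewrite normrM ger0_norm// (le_lt_trans _ t1)// ler_piMl.
  split; last by have [] := S12 (s * t, t) (conj (dS1 _ st) (dS2 _ t2)).
  have := S12 (s * t, 0) (conj (dS1 _ st) (dS2 0 _)).
  by rewrite /= scale0r addr0 normr0; apply.
pose g (s : R) := t^-1 *: (t^-1 *: f (x + t *: w + (s * t) *: v)
   - t^-1 *: f (x + (s * t) *: v)).
have : C (g 1 - g 0).
  apply: (mean_value (dg := fun s =>
    t^-1 *: (df (x + (s * t) *: v + t *: w, v) - df (x + (s * t) *: v, v)))) =>
      // s s01.
  have [[Ds Ns] Dsw] := inDN s s01; split; last first.
    apply: (NT (_, t)) => //; [by split => //; exact: dT| |];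
      exact: interior_subset.
  have hW := lcs_tvs lW.
  have h1 := gateaux_reparam t0 (strict_line hV Ds (hf _ v (interior_subset
    Ds))).
  have Dsw' : D° (x + t *: w + (s * t) *: v) by rewrite addrAC.
  have h2 := gateaux_reparam t0 (strict_line hV Dsw' (hf _ v (interior_subset
    Dsw'))).
  rewrite addrAC.
  apply: cvg_eq_near (tvs_cvgZ hW (@cvg_cst _ (t^-1) _ (0 : R)^' _)
    (tvs_cvgB hW h2 h1)).
  near=> h; rewrite /g.
  rewrite -scalerBr -[in RHS]scalerBr !scalerA [h^-1 * _]mulrC.
  by congr (_ *: _); rewrite !opprB addrACA [RHS]addrACA [- _ - _]addrC.
congr C; rewrite /g mul1r mul0r scale0r !addr0 -scalerBr -!scalerBr scalerA.
by congr (_ *: _); rewrite (addrAC x).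
Unshelve. all: by end_near. Qed.

(* Both sides are limits of the same second difference, symmetric in v and w. *)
Lemma schwarz V W (D : set V) (f : V -> W) (df : V * V -> W)
    (ddf : (V * V) * (V * V) -> W) (x v w : V) :
  fat D -> lcs W -> has_derivative D f df ->
  has_derivative (D `*` setT) df ddf -> cont_on ((D `*` setT) `*` setT) ddf ->
  D x -> ddf ((x, v), (w, 0)) = ddf ((x, w), (v, 0)).
Proof.
move=> fD lW hf hdf cddf Dx; have hV := fD.1; have hW := lcs_hausdorff lW.
have int y : D° y -> ddf ((y, v), (w, 0)) = ddf ((y, w), (v, 0)).
  move=> Dy; have h1 := second_difference (v := v) (w := w) hV lW hf hdf Dy.
  suff h2 : (fun t : R => (t^-1 * t^-1) *:
      (f (y + t *: v + t *: w) - f (y + t *: v) - (f (y + t *: w) - f y)))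
      @ (0 : R)^' --> ddf ((y, w), (v, 0)) by exact: (cvg_unique hW h1 h2).
  apply: cvg_eq_near (second_difference (v := w) (w := v) hV lW hf hdf Dy);
    apply: nearW => t.
  congr (_ *: _); rewrite [y + _ + _]addrAC !opprB addrACA [RHS]addrACA.
  by congr (_ + _); rewrite addrC.
have FF := fat_within_interior fD Dx.
have c u z : ddf ((y, u), (z, 0)) @[y --> within D° (nbhs x)] --> ddf ((x, u),
  (z, 0)).
  apply: cddf => //.
    apply: cvg_pair_nbhs; last exact: cvg_cst.
    by apply: cvg_pair_nbhs; [exact: cvg_within|exact: cvg_cst].
  apply: filterS (withinT _ _) => y Dy; split => //; split => //.
  exact: interior_subset.
suff h : ddf ((y, v), (w, 0)) @[y --> within D° (nbhs x)] --> ddf ((x, w), (v,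
  0)).
  exact: (cvg_unique hW (c v w) h).
apply: cvg_eq_near (c w v).
by apply: filterS (withinT _ _) => y /int.
Qed.

Lemma dmap_sym V W (D : set V) (f : V -> W) (x v w : V) :
  fat D -> lcs W -> Csm D f -> D x ->
  dmap (D `*` setT) (dmap D f) ((x, v), (w, 0)) =
  dmap (D `*` setT) (dmap D f) ((x, w), (v, 0)).
Proof.
move=> fD lW sf Dx; have hW := lcs_hausdorff lW.
have [hf sdf] := Csm_dmap hW fD sf.
have [hdf sddf] := Csm_dmap hW (fat_setXT fD.1 fD) sdf.
exact: schwarz hf hdf (Cn_cont (sddf 0%N)) Dx.
Qed.

End second_derivative.

(** * Comparison with iterated directional derivatives *)

Lemma cvg_initial (S : choiceType) (T : topologicalType) (f : S -> T) X
    (F : set_system X) (g : X -> S) (s : S) : Filter F ->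
  ((g : X -> initial_topology f) @ F --> (s : initial_topology f)) <->
  ((fun k => f (g k)) @ F --> f s).
Proof.
move=> FF; split=> [gs|fgs].
  exact: (cvg_comp _ (f : initial_topology f -> T) gs
    (@initial_continuous _ _ f s)).
move=> A; rewrite nbhsE => -[B [[C oC <-] Cfs] BA].
have := fgs _ (open_nbhs_nbhs (conj oC Cfs)).
by rewrite /= !nbhs_simpl /=; apply: filterS => k /= Ck; exact: BA.
Qed.

Lemma cvg_prod_topology (I : Type) (T : I -> topologicalType) X
    (F : set_system X) (g : X -> prod_topology T) (s : prod_topology T) :
  Filter F ->
  (g @ F --> s) <-> (forall i, (fun k => g k i) @ F --> s i).
Proof.
move=> FF; split=> [gs i|gs].
  by move/cvg_sup: gs => /(_ i); rewrite cvg_initial.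
by apply/cvg_sup => i; apply/(cvg_initial (fun f : forall i, T i => f i)).
Qed.

Section smooth_on_calculus.
Context {R : realType}.
Implicit Types V W E : preTopologicalLmodType R.

Lemma tvs_cvg_sum W X (F : set_system X) {FF : Filter F} n
    (u : 'I_n -> X -> W) (l : 'I_n -> W) : tvs_like W ->
  (forall i, u i @ F --> l i) ->
  (fun k => \sum_(i < n) u i k) @ F --> \sum_(i < n) l i.
Proof.
move=> hW; elim: n u l => [|n IH] u l ul.
  rewrite big_ord0; apply: cvg_eq_near (@cvg_cst _ (0 : W) _ F FF).
  by apply: nearW => k; rewrite big_ord0.
rewrite big_ord_recr /=.
apply: (@cvg_eq_near _ _ _ _
  (fun k => \sum_(i < n) u (widen_ord (leqnSn n) i) k + u ord_max k)).
  by apply: nearW => k; rewrite big_ord_recr.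
apply: tvs_cvgD => //; exact: IH.
Qed.

Lemma pair_line V W (a v : V) (b w : W) (t : R) :
  (a, b) + t *: (v, w) = (a + t *: v, b + t *: w) :> V * W.
Proof. by []. Qed.

Lemma setXT_interior V W (D : set V) (z : V * W) :
  (D `*` [set: W])° z -> D° z.1.
Proof.
case=> -[A B] [/= nA nB] AB; rewrite /interior.
by apply: filterS nA => x Ax; have [] := AB (x, z.2)
  (conj Ax (nbhs_singleton nB)).
Qed.

Lemma interior_setXT V W (D : set V) (z : V * W) :
  D° z.1 -> (D `*` [set: W])° z.
Proof. by move=> Dz; apply: nbhs_setX => //; exact: filterT. Qed.

Definition scons T (v : T) (s : nat -> T) (k : nat) : T :=
  if k is j.+1 then s j else v.

(* The maps d of [smooth_on], with the n directions read off a sequence. *)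
Record jets V W (D : set V) (f : V -> W)
    (d : nat -> V -> (nat -> V) -> W) : Prop := Jets {
  jets_ext : forall n x s s', (forall i, (i < n)%N -> s i = s' i) ->
    d n x s = d n x s';
  jets0 : forall x s, D x -> d 0%N x s = f x;
  jets_cont : forall n X (F : set_system X) (a : X -> V) (s : X -> nat -> V)
    x s0,
    Filter F -> D x -> a @ F --> x -> (\forall k \near F, D (a k)) ->
    (forall i, (fun k => s k i) @ F --> s0 i) ->
    (fun k => d n (a k) (s k)) @ F --> d n x s0;
  jets_deriv : forall n x s, D° x ->
    (fun h : R => h^-1 *: (d n (x + h *: s n) s - d n x s)) @ (0 : R)^' -->
      d n.+1 x s }.

Lemma smooth_on_jets V W (D : set V) (f : V -> W) :
  smooth_on D f -> exists d, jets D f d.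
Proof.
move=> [d [dc d0 dd]]; exists (fun n x s => d n (x, fun i : 'I_n => s i)).
split.
- move=> n x s s' e; congr (d n (x, _)); apply/funext => i; exact: e.
- by move=> x s Dx; exact: d0.
- move=> n X F a s x s0 FF Dx ax Da ss0.
  have /subspace_continuousP h := dc n.
  apply: (cvg_comp _ _ _ (h (x, (fun i : 'I_n => s0 i) : {ptws 'I_n -> V}) _))
    => //.
  move=> U WU.
  have : F [set k | D (a k) -> U (a k, (fun i : 'I_n => s k i) : {ptws 'I_n ->
    V})].
    have : (fun k => (a k, (fun i : 'I_n => s k i) : {ptws 'I_n -> V})) @ F -->
        (x, (fun i : 'I_n => s0 i) : {ptws 'I_n -> V}).
      apply: cvg_pair_nbhs => //.
      by apply/cvg_prod_topology => i; exact: ss0.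
    move=> /(_ _ WU); apply: (@filterS _ F) => k h1 Dk; exact: h1.
  by apply: filterS2 Da => k Dk; apply.
- move=> n x s Dx; exact: (dd n x (fun i : 'I_n.+1 => s i) Dx).
Qed.

Lemma jets_derivative V W (D : set V) (f : V -> W) d :
  fat D -> lcs W -> jets D f d ->
  has_derivative D f (fun z => d 1%N z.1 (scons z.2 (fun=> 0))).
Proof.
move=> fD lW jd; apply: gateaux_strict => //.
- move=> X F a x FF Dx ax Da; rewrite -(jets0 jd (fun=> 0) Dx).
  apply: cvg_eq_near (jets_cont (n := 0) jd FF Dx ax Da (s := fun=> fun=> 0) _).
    by apply: filterS Da => k Dk; rewrite (jets0 jd).
  by move=> i; exact: cvg_cst.
- move=> X F a [x v] FF [/= Dx _] az Da.
  apply: (jets_cont jd) => //.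
  + exact: (cvg_fst_comp az).
  + by apply: filterS Da => k [].
  + by case=> [|i]; [exact: (cvg_snd_comp az)|exact: cvg_cst].
- move=> x v Dx; apply: cvg_eq_near (jets_deriv jd (s := scons v (fun=> 0)) Dx).
  have Dxh : \forall h \near (0 : R)^', D (x + h *: v).
    by apply: cvg_within; apply: near_line_interior => //; exact: fD.1.
  apply: filterS Dxh => h Dh.
  by rewrite (jets0 jd _ Dh) (jets0 jd _ (interior_subset Dx)).
Qed.

(** The increment along v + t u is the increment along [v] from [x] plus the one along t u from the
    moving point x + h v; a strict derivative allows this moving base point. *)
Lemma derivative_linear V W (D : set V) (f : V -> W) df (x v u : V) (t : R) :
  tvs_like V -> lcs W -> has_derivative D f df -> D° x ->
  df (x, v + t *: u) = df (x, v) + t *: df (x, u).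
Proof.
move=> hV lW hf Dx; have hW := lcs_hausdorff lW.
have Dx' := interior_subset Dx.
have h1 := strict_line hV Dx (hf x (v + t *: u) Dx').
suff h2 : (fun h : R => h^-1 *: (f (x + h *: (v + t *: u)) - f x))
  @ (0 : R)^' -->
    df (x, v) + t *: df (x, u) by exact: (cvg_unique hW h1 h2).
(* For t = 0 the parameter t h vanishes and strictness says nothing; the term is then multiplied by
   0 anyway. *)
have h3 : (fun h : R => quot f (x + h *: v) u (t * h)) @ (0 : R)^' --> df (x, u)
  \/ t = 0.
  have [->|t0] := eqVneq t 0; [by right|left].
  apply: (hf _ _ Dx') => //.
  - by apply: cvg_within_filter; exact: cvg_line0.
  - exact: cvg_cst.
  - by apply: (cvg_trans (dnbhs0_scale t0)); exact: cvg_within.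
  - near=> h; split.
    + near: h; apply: cvg_within; exact: near_line_interior.
    + rewrite -addrA [t * h]mulrC -scalerA -scalerDr.
      near: h; apply: cvg_within; exact: near_line_interior.
    + rewrite mulf_neq0//; near: h; exact: nbhs_dnbhs_neq.
have h4 : (fun h : R => t *: quot f (x + h *: v) u (t * h)) @ (0 : R)^' -->
    t *: df (x, u).
  case: h3 => [h3|->]; first by apply: tvs_cvgZ => //;
    [exact: lcs_tvs|exact: cvg_cst].
  rewrite scale0r; apply: cvg_eq_near (cvg_cst (0 : W)).
  by apply: nearW => h; rewrite scale0r.
apply: cvg_eq_near (tvs_cvgD (lcs_tvs lW) (strict_line hV Dx (hf x v Dx')) h4).
near=> h; rewrite /quot.
have h0 : h != 0 by near: h; exact: nbhs_dnbhs_neq.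
have [->|t0] := eqVneq t 0; first by rewrite !scale0r !addr0.
rewrite scalerA invfM mulrA mulfV// mul1r -scalerDr; congr (_ *: _).
by rewrite [LHS]addrC addrA subrK scalerDr scalerA [h * t]mulrC addrA.
Unshelve. all: by end_near. Qed.

(** Later directions are appended at the end of the sequence by differentiating, and linearity in
    the first direction passes to the limit of the quotients. The case n = 0 is
    [derivative_linear]. *)
Lemma jets_linear V W (D : set V) (f : V -> W) d n x v u (t : R) s :
  fat D -> lcs W -> jets D f d -> D° x ->
  d n.+1 x (scons (v + t *: u) s) =
  d n.+1 x (scons v s) + t *: d n.+1 x (scons u s).
Proof.
move=> fD lW jd; have hV := fD.1; have hW := lcs_hausdorff lW.
elim: n x => [|n IH] x Dx.
  have e w : d 1%N x (scons w s) = d 1%N x (scons w (fun=> 0)).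
    by apply: (jets_ext jd) => -[].
  rewrite !e.
  exact: (derivative_linear v u t hV lW (jets_derivative fD lW jd) Dx).
have D' w := jets_deriv jd (n := n.+1) (s := scons w s) Dx.
suff h : (fun h : R => h^-1 *: (d n.+1 (x + h *: s n) (scons (v + t *: u) s)
      - d n.+1 x (scons (v + t *: u) s))) @ (0 : R)^' -->
    d n.+2 x (scons v s) + t *: d n.+2 x (scons u s).
  exact: (cvg_unique hW (D' (v + t *: u)) h).
have hW' := lcs_tvs lW.
apply: cvg_eq_near (tvs_cvgD hW' (D' v) (tvs_cvgZ hW' (cvg_cst t) (D' u))).
near=> h; rewrite !IH//.
  rewrite scalerA mulrC -scalerA -scalerDr; congr (_ *: _).
  by rewrite scalerBr opprD addrACA.
near: h; apply: cvg_within.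
by apply: (near_line_interior (D := D°)) => //; exact: nbhs_interior.
Unshelve. all: by end_near. Qed.

(* The jets of [(x, v) |-> D_v f x]: as [D_v f x] is linear in [v], each
   direction [(w_j, u_j)] either differentiates in [x] along [w_j] or replaces
   [v] by [u_j], the latter for at most one [j]. *)
Definition djets V W (d : nat -> V -> (nat -> V) -> W) (n : nat) (z : V * V)
    (s : nat -> V * V) : W :=
  d n.+1 z.1 (scons z.2 (fun k => (s k).1)) +
  \sum_(j < n) d n z.1 (scons (s j).2 (fun k => (s (bump j k)).1)).

Lemma jets_djets V W (D : set V) (f : V -> W) d : fat D -> lcs W ->
  jets D f d ->
  jets (D `*` setT) (fun z => d 1%N z.1 (scons z.2 (fun=> 0))) (djets d).
Proof.
move=> fD lW jd; have hV := fD.1; have hW := lcs_tvs lW.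
split.
- move=> n z s s' e; rewrite /djets; congr (_ + _).
    by apply: (jets_ext jd) => -[|i] //=; rewrite ltnS => /e ->.
  apply: eq_bigr => j _; apply: (jets_ext jd) => -[|i] /= ilt;
    first by rewrite e.
  by rewrite e// (leq_ltn_trans _ ilt)// /bump -add1n leq_add2r leq_b1.
- move=> z s _; rewrite /djets big_ord0 addr0.
  by apply: (jets_ext jd) => -[].
- move=> n X F a s z s0 FF [/= Dz _] az Da ss0.
  have az1 := cvg_fst_comp az; have az2 := cvg_snd_comp az.
  have Da1 : \forall k \near F, D (a k).1 by apply: filterS Da => k [].
  apply: tvs_cvgD => //.
    apply: (jets_cont jd) => // -[|i] //; exact: (cvg_fst_comp (ss0 i)).
  apply: tvs_cvg_sum => // j; apply: (jets_cont jd) => // -[|i].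
    exact: (cvg_snd_comp (ss0 j)).
  exact: (cvg_fst_comp (ss0 (bump j i))).
- move=> n z s /setXT_interior Dz.
  (* Since [v] moves together with the base point, linearity in the first direction splits off a
     term with a factor [h] that cancels in the quotient. Its limit is the last summand, of index
     [n], in the next sum. *)
  pose T0 (h : R) := d n.+1 (z.1 + h *: (s n).1) (scons (s n).2 (fun k =>
    (s k).1)).
  have c0 : T0 @ (0 : R)^' --> d n.+1 z.1 (scons (s n).2 (fun k => (s k).1)).
    apply: (jets_cont jd) => //; first exact: interior_subset.
    + by apply: cvg_within_filter; exact: cvg_line0.
    + by apply: cvg_within; exact: near_line_interior.
    + by move=> i; exact: cvg_cst.
  have c1 := jets_deriv jd (n := n.+1) (s := scons z.2 (fun k => (s k).1)) Dz.
  have c2 (j : 'I_n) : (fun h : R => h^-1 *: (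
      d n (z.1 + h *: (s n).1) (scons (s j).2 (fun k => (s (bump j k)).1)) -
      d n z.1 (scons (s j).2 (fun k => (s (bump j k)).1)))) @ (0 : R)^' -->
      d n.+1 z.1 (scons (s j).2 (fun k => (s (bump j k)).1)).
    have := jets_deriv jd (n := n) (s := scons (s j).2 (fun k =>
      (s (bump j k)).1)) Dz.
    (* Slot 0 is occupied by [(s j).2] and the index [j] is skipped; as j < n, the two shifts cancel
       at position [n], which still holds the newest direction. *)
    have -> // : scons (s j).2 (fun k => (s (bump j k)).1) n = (s n).1.
    case: n j {c0 c1 T0} => [[]//|n] j /=.
    by rewrite /bump -ltnS ltn_ord add1n.
  have -> : djets d n.+1 z s =
      (d n.+2 z.1 (scons z.2 (fun k => (s k).1)) +
       d n.+1 z.1 (scons (s n).2 (fun k => (s k).1))) +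
      \sum_(j < n) d n.+1 z.1 (scons (s j).2 (fun k => (s (bump j k)).1)).
    rewrite /djets big_ord_recr /= -addrA; congr (_ + _); rewrite addrC;
      congr (_ + _).
    apply: (jets_ext jd) => -[|i] //=; rewrite ltnS => ilt.
    by rewrite /bump leqNgt ilt.
  apply: cvg_eq_near (tvs_cvgD hW (tvs_cvgD hW c1 c0) (tvs_cvg_sum hW c2)).
  near=> h.
  have h0 : h != 0 by near: h; exact: nbhs_dnbhs_neq.
  rewrite /djets -scaler_sumr /T0.
  have -> : (z + h *: s n).2 = z.2 + h *: (s n).2 by [].
  have -> : (z + h *: s n).1 = z.1 + h *: (s n).1 by [].
  rewrite (jets_linear _ _ _ _ _ fD lW jd); last first.
    near: h; apply: cvg_within; apply: (near_line_interior (D := D°)) => //.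
    exact: nbhs_interior.
  rewrite sumrB -[X in _ + X + _](scale1r) -(mulVf h0) -scalerA -!scalerDr.
  by congr (_ *: _); rewrite opprD [RHS]addrACA; congr (_ + _); rewrite addrAC.
Unshelve. all: by end_near. Qed.

Lemma jets_Csm V W (D : set V) (f : V -> W) d :
  fat D -> lcs W -> jets D f d -> Csm D f.
Proof.
move=> fD lW jd n; elim: n V D f d fD jd => [|n IH] V D f d fD jd.
  split=> // X F a x FF Dx ax Da; rewrite -(jets0 jd (fun=> 0) Dx).
  apply: cvg_eq_near (jets_cont (n := 0) jd FF Dx ax Da (s := fun=> fun=> 0) _).
    by apply: filterS Da => k Dk; rewrite (jets0 jd).
  by move=> i; exact: cvg_cst.
split.
  move=> X F a x FF Dx ax Da; rewrite -(jets0 jd (fun=> 0) Dx).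
  apply: cvg_eq_near (jets_cont (n := 0) jd FF Dx ax Da (s := fun=> fun=> 0) _).
    by apply: filterS Da => k Dk; rewrite (jets0 jd).
  by move=> i; exact: cvg_cst.
eexists; first exact: jets_derivative fD lW jd.
apply: IH (jets_djets fD lW jd); exact: fat_setXT fD.1 fD.
Qed.

Lemma smooth_on_Csm V W (D : set V) (f : V -> W) :
  fat D -> lcs W -> smooth_on D f -> Csm D f.
Proof. by move=> fD lW /smooth_on_jets[d]; exact: jets_Csm. Qed.

(** The iterated directional derivative, computed through derivatives on the doubled space: the
    second components are 0 because a direction already used stays constant under further
    differentiation. *)
Fixpoint jet (n : nat) V W (D : set V) (f : V -> W) (x : V) (s : nat -> V)
  : W :=
  if n is m.+1 then
    jet m (D `*` setT) (dmap D f) (x, s 0%N) (fun i => (s i.+1, 0))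
  else f x.

Lemma Csm_smooth_on V W (D : set V) (f : V -> W) :
  hausdorff_space W -> fat D -> Csm D f -> smooth_on D f.
Proof.
move=> hW fD sf.
have jext n V' (D' : set V') (g : V' -> W) x s s' :
    (forall i, (i < n)%N -> s i = s' i) -> jet n D' g x s = jet n D' g x s'.
  elim: n V' D' g x s s' => [|n IH] V' D' g x s s' e //=.
  by rewrite e//; apply: IH => i ilt; rewrite e.
have jcont n V' (D' : set V') (g : V' -> W) X (F : set_system X) a
    (s : X -> nat -> V') x s0 : fat D' -> Csm D' g -> Filter F -> D' x ->
    a @ F --> x -> (\forall k \near F, D' (a k)) ->
    (forall i, (fun k => s k i) @ F --> s0 i) ->
    (fun k => jet n D' g (a k) (s k)) @ F --> jet n D' g x s0.
  elim: n V' D' g a s x s0 =>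
    [|n IH] V' D' g a s x s0 fD' sg FF Dx ax Da ss0 /=.
    exact: (Cn_cont (sg 0%N)).
  apply: IH => //.
  - exact: fat_setXT fD'.1 fD'.
  - exact: (Csm_dmap hW fD' sg).2.
  - exact: cvg_pair_nbhs.
  - by apply: filterS Da => k.
  - by move=> i; apply: cvg_pair_nbhs => //; exact: cvg_cst.
have jderiv n V' (D' : set V') (g : V' -> W) x s : fat D' -> Csm D' g ->
  D'° x ->
    (fun h : R => h^-1 *: (jet n D' g (x + h *: s n) s - jet n D' g x s))
      @ (0 : R)^' --> jet n.+1 D' g x s.
  elim: n V' D' g x s => [|n IH] V' D' g x s fD' sg Dx.
    exact: (strict_line fD'.1 Dx
      ((Csm_dmap hW fD' sg).1 x (s 0%N) (interior_subset Dx))).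
  have Dxs : (D' `*` [set: V'])° (x, s 0%N) by exact: interior_setXT.
  have := IH _ (D' `*` setT) (dmap D' g) (x, s 0%N) (fun i => (s i.+1, 0))
    (fat_setXT fD'.1 fD') (Csm_dmap hW fD' sg).2 Dxs.
  move=> h; apply: cvg_eq_near h; apply: nearW => h /=.
  by rewrite pair_line scaler0 addr0.
(* The default 0 beyond the first [n] entries is arbitrary: by [jext], [jet n] reads only those
   entries. *)
pose ext n (v : 'I_n -> V) (k : nat) : V :=
  if (insub k : option 'I_n) is Some i then v i else 0.
exists (fun n z => jet n D f z.1 (ext n z.2)); split.
- move=> n; apply/subspace_continuousP => -[x v] [/= Dx _].
  have wid : id @ within (D `*` [set: {ptws 'I_n -> V}]) (nbhs (x, v)) --> (x,
    v).
    exact: cvg_within.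
  apply: jcont => //.
  + exact: (cvg_fst_comp wid).
  + by apply: filterS (withinT _ _) => k [].
  + move=> i; rewrite /ext; case: insubP => [j _ _|_]; last exact: cvg_cst.
    by have /cvg_prod_topology := cvg_snd_comp wid; exact.
- by [].
- move=> n x v Dx.
  have := jderiv n V D f x (ext n.+1 v) fD sf Dx.
  have -> : ext n.+1 v n = v ord_max.
    rewrite /ext; case: insubP => [j _ jn|]; last by rewrite ltnSn.
    by congr v; exact: val_inj.
  have e y : jet n D f y (ext n.+1 v) =
      jet n D f y (ext n (fun i => v (widen_ord (leqnSn n) i))).
    apply: jext => i ilt; rewrite /ext.
    case: insubP => [j _ ji|]; last by rewrite ltnS ltnW.
    case: insubP => [j' _ j'i|]; last by rewrite ilt.
    by congr v; apply: val_inj; rewrite /= ji j'i.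
  by rewrite e; under eq_fun do rewrite e.
Qed.

End smooth_on_calculus.

(** * Tangent atlases *)

Section charts.
Context {R : realType}.
Implicit Types V W E : preTopologicalLmodType R.

Definition locally_compact_space (X : topologicalType) := forall (x : X) N,
  nbhs x N -> exists K, [/\ compact K, nbhs x K & K `<=` N].

Lemma locally_compact_prod (X Y : topologicalType) :
  locally_compact_space X -> locally_compact_space Y ->
  locally_compact_space (X * Y)%type.
Proof.
move=> hX hY [x y] N [[A B] /= [nA nB] AB].
have [K [cK nK KA]] := hX x A nA; have [L [cL nL LB]] := hY y B nB.
exists (K `*` L); split; [exact: compact_setX|exact: nbhs_setX|].
by move=> [a b] [/= Ka Lb]; apply: AB; split; [exact: KA|exact: LB].
Qed.

(** Convexity and an interior point make chart images [fat]; closedness together with local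
    compactness yields compact neighbourhoods inside [S]. All of this passes to the model of the
    tangent bundle ([model_setXT]), so tangent functors can be iterated. *)
Record model_set V (S : set V) : Prop := ModelSet {
  model_lcs : lcs V;
  model_convex : segment_convex S;
  model_interior : exists e, S° e;
  model_closed : closed S;
  model_locally_compact : locally_compact_space V }.

Lemma model_setXT V (S : set V) : model_set S ->
  model_set (S `*` [set: V] : set (V * V)%type).
Proof.
move=> [lV cS [e Se] clS lc]; split.
- exact: lcs_prod.
- by move=> x y t [? _] [? _] ?; split => //; exact: cS.
- by exists (e, 0); exact: interior_setXT.
- rewrite setXT; apply: preimage_closed clS => x _;
    exact: (cvg_fst_comp (@cvg_id _ (nbhs x))).
- exact: locally_compact_prod.
Qed.

Lemma model_fat V (S O : set V) : model_set S -> open O -> fat (O `&` S).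
Proof.
by move=> [lV cS [e Se] _ _] oO; split; [exact: lcs_tvs|exists O, S, e].
Qed.

(** Each [derive_within] is taken on its own domain. All three restrict to strict derivatives on the
    common fat set [D], where the chain rule and uniqueness apply. *)
Lemma dchain V W E (D D1 D3 : set V) (D2 : set W) (h : V -> E) (g : W -> E)
    (k : V -> W) (x v : V) :
  hausdorff_space W -> hausdorff_space E ->
  fat D -> fat D1 -> fat D2 -> fat D3 -> D `<=` D1 -> D `<=` D3 ->
  (forall y, D y -> D2 (k y)) -> (forall y, D y -> h y = g (k y)) ->
  Csm D1 h -> Csm D2 g -> Csm D3 k -> D x ->
  derive_within D1 h x v = derive_within D2 g (k x) (derive_within D3 k x v).
Proof.
move=> hW hE fD fD1 fD2 fD3 s1 s3 kD e sh sg sk Dx.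
have h1 : strict_derive D h x v (derive_within D1 h x v).
  exact: strict_sub s1 _ ((Csm_dmap hE fD1 sh).1 x v (s1 _ Dx)).
apply: (strict_unique hE fD Dx h1).
apply: (strict_sub (f := g \o k) (D := D)) => //; first by move=> y /e.
have k1 : strict_derive D k x v (derive_within D3 k x v).
  exact: strict_sub s3 _ ((Csm_dmap hW fD3 sk).1 x v (s3 _ Dx)).
apply: strict_comp kD Dx k1 ((Csm_dmap hE fD2 sg).1 _ _ (kD _ Dx)).
by apply: cont_on_sub s3 _ (Cn_cont (sk 0%N)).
Qed.

Section good_atlas.
Context {T : Type} {V : preTopologicalLmodType R}.
Variables (S : set V) (A : atlas T V).

(** The conditions on charts in [is_manifold], with smoothness in the strict form.
    [good_tangent_atlas] reproduces them on the tangent bundle. *)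
Record good_atlas : Prop := GoodAtlas {
  good_at : forall p, dom (chart_at A p) p;
  good_inv : forall (i : chart_index A) p, dom i p -> chart_inv i (chart i p) =
    p;
  good_open : forall i j : chart_index A, exists2 O : set V,
    open O & chart i @` (dom i `&` dom j) = O `&` S;
  good_trans : forall i j : chart_index A,
    Csm (chart i @` (dom i `&` dom j)) (chart j \o chart_inv i) }.

Local Notation overlap i j := (chart (a := A) i @` (dom (a := A) i `&` dom (a :=
  A) j)).

Hypothesis mS : model_set S.
Hypothesis gA : good_atlas.
Let hV : hausdorff_space V := lcs_hausdorff (model_lcs mS).

Definition chart_dom (i : chart_index A) : set V := chart i @` dom i.

Lemma overlap_fat i j : fat (overlap i j).
Proof. by have [Q oQ ->] := good_open gA i j; exact: model_fat. Qed.

Lemma chart_domE i : chart_dom i = overlap i i.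
Proof. by rewrite setIid. Qed.

Lemma chart_dom_fat i : fat (chart_dom i).
Proof. by rewrite chart_domE; exact: overlap_fat. Qed.

Lemma chart_dom_open i : exists2 O : set V, open O & chart_dom i = O `&` S.
Proof. by rewrite chart_domE; exact: (good_open gA). Qed.

Lemma overlapP i j x : (overlap i j) x ->
  [/\ dom i (chart_inv i x), dom j (chart_inv i x) &
      chart i (chart_inv i x) = x].
Proof. by move=> [p [ip jp] <-]; rewrite (good_inv gA). Qed.

Lemma chart_domP i x : chart_dom i x ->
  dom i (chart_inv i x) /\ chart i (chart_inv i x) = x.
Proof. by rewrite chart_domE => /overlapP[]. Qed.

Lemma overlap_chart i j p : dom (a := A) i p -> dom j p ->
  (overlap i j) (chart i p).
Proof. by move=> ip jp; exists p. Qed.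

Definition dtrans (i j : chart_index A) : V -> V -> V :=
  derive_within (overlap i j) (chart j \o chart_inv i).

Lemma dtrans_comp i j k p v : dom i p -> dom j p -> dom k p ->
  dtrans i k (chart i p) v = dtrans j k (chart j p) (dtrans i j (chart i p) v).
Proof.
move=> ip jp kp; rewrite /dtrans.
have [Q1 oO1 e1] := good_open gA i j; have [Q2 oO2 e2] := good_open gA i k.
pose D := (Q1 `&` Q2) `&` S.
have s1 : D `<=` overlap i j by rewrite e1 => y [[]].
have s2 : D `<=` overlap i k by rewrite e2 => y [[]].
have Dp : D (chart i p).
  have : (Q1 `&` S) (chart i p) by rewrite -e1; exact: overlap_chart.
  have : (Q2 `&` S) (chart i p) by rewrite -e2; exact: overlap_chart.
  by move=> [? ?] [].
have -> : chart j p = (chart j \o chart_inv i) (chart i p).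
  by rewrite /= (good_inv gA).
apply: (dchain (D := D)) => //.
- by apply: model_fat => //; exact: openI.
- exact: overlap_fat.
- exact: overlap_fat.
- exact: overlap_fat.
- move=> y Dy; have [_ jy _] := overlapP (s1 _ Dy).
  by have [_ ky _] := overlapP (s2 _ Dy); exact: overlap_chart.
- move=> y Dy /=; have [_ jy _] := overlapP (s1 _ Dy).
  by rewrite (good_inv gA).
- exact: (good_trans gA).
- exact: (good_trans gA).
- exact: (good_trans gA).
Qed.

Lemma dtrans_id i p v : dom i p -> dtrans i i (chart i p) v = v.
Proof.
move=> ip; apply: dmapE => //.
- exact: overlap_fat.
- exact: (good_trans gA).
- exact: overlap_chart.
- apply: (strict_sub (f := id) (D := setT)) => //.
    by move=> x /overlapP[_ _ /= ->].
  move=> X F a b t FF ax bv t0 Dab; apply: cvg_eq_near bv.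
  apply: filterS Dab => k [_ _ tk].
  by rewrite /quot addrAC subrr add0r scalerA mulVf// scale1r.
Qed.

Lemma dtransK i j p v : dom i p -> dom j p ->
  dtrans j i (chart j p) (dtrans i j (chart i p) v) = v.
Proof. by move=> ip jp; rewrite -dtrans_comp// dtrans_id. Qed.

Lemma tangent_overlap i j :
  chart (a := tangent_atlas A) i @` (dom (a := tangent_atlas A) i `&`
    dom (a := tangent_atlas A) j) =
  (overlap i j) `*` setT.
Proof.
apply/seteqP; split.
  by move=> _ [[p v] [/= [ip _] [jp _]] <-]; split => //=; exists p.
move=> [x w] [/= ij _]; have [ip jp px] := overlapP ij.
exists (chart_inv (a := tangent_atlas A) i (x, w)); first by split; split.
rewrite /= -/(dtrans _ _) -/(dtrans _ _) px; congr (_, _).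
move: ip px; set p := chart_inv (a := A) i x => ip px.
by rewrite -px dtransK//; exact: (good_at gA).
Qed.

Lemma tangent_chart_dom i : chart (a := tangent_atlas A) i @`
    dom (a := tangent_atlas A) i = chart_dom i `*` setT.
Proof. by have := tangent_overlap i i; rewrite !setIid. Qed.

(** The coordinates stored in a tangent vector refer to the chart chosen at its base point; the
    cocycle identity [dtrans_comp] cancels this choice. *)
Lemma tangent_transE i j x w : (overlap i j) x ->
  chart (a := tangent_atlas A) j (chart_inv (a := tangent_atlas A) i (x, w)) =
  locT (overlap i j) (chart j \o chart_inv i) (x, w).
Proof.
move=> ij; have [ip jp px] := overlapP ij.
rewrite /locT /= -/(dtrans _ _) -/(dtrans _ _) -/(dtrans _ _); congr (_, _).
move: ip jp px; set p := chart_inv (a := A) i x => ip jp px.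
by rewrite -px -dtrans_comp//; exact: (good_at gA).
Qed.

Definition csm_on E (f : T -> E) :=
  forall i : chart_index A, Csm (chart_dom i) (f \o chart_inv i).

Lemma tangent_mapE E (f : T -> E) i x w : hausdorff_space E -> csm_on f ->
  chart_dom i x ->
  tangent_map A f (chart_inv (a := tangent_atlas A) i (x, w)) =
  locT (chart_dom i) (f \o chart_inv i) (x, w).
Proof.
move=> hE sf ix; have [ip px] := chart_domP ix.
set p := chart_inv i x in ip px; pose c := chart_at A p.
have cp : dom c p by exact: (good_at gA).
rewrite /tangent_map /locT /= -/p -/c -/(dtrans _ _); congr (_, _).
rewrite -/(chart_dom _) -/(chart_dom _); apply/esym.
have -> : chart c p = (chart c \o chart_inv i) x by [].
have sub : overlap i c `<=` chart_dom i.
  by move=> _ [q [iq _] <-]; exists q.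
apply: (dchain (D := overlap i c)) => //.
- exact: overlap_fat.
- exact: chart_dom_fat.
- exact: chart_dom_fat.
- exact: overlap_fat.
- by move=> y /overlapP[_ cy _]; exists (chart_inv i y).
- by move=> y /overlapP[_ cy _] /=; rewrite (good_inv gA).
- exact: (good_trans gA).
- by rewrite -px; exact: overlap_chart.
Qed.

End good_atlas.

Lemma good_tangent_atlas T V (S : set V) (A : atlas T V) :
  model_set S -> good_atlas S A ->
  good_atlas (S `*` [set: V]) (tangent_atlas A).
Proof.
move=> mS gA; split.
- by move=> p; split => //; exact: (good_at gA).
- move=> i [p v] [/= ip _]; rewrite (good_inv gA)//; congr (_, _).
  by apply: (dtransK mS gA) => //; exact: (good_at gA).
- move=> i j; rewrite (tangent_overlap mS gA).
  have [Q oQ ->] := good_open gA i j.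
  by exists (Q `*` setT); [exact: open_setX openT|rewrite -setXI setIid].
- move=> i j n; rewrite (tangent_overlap mS gA).
  apply: Cn_sub (Csm_locT _ _ (good_trans gA i j) n) => //.
  + by move=> [x w] [/= ij _]; rewrite -(tangent_transE mS gA).
  + exact: lcs_hausdorff (model_lcs mS).
  + exact: overlap_fat mS gA _ _.
Qed.

Lemma csm_on_tangent T V (S : set V) (A : atlas T V) E (f : T -> E) :
  model_set S -> good_atlas S A -> hausdorff_space E -> csm_on A f ->
  csm_on (tangent_atlas A) (tangent_map A f).
Proof.
move=> mS gA hE sf i n; rewrite /chart_dom (tangent_chart_dom mS gA).
apply: Cn_sub (Csm_locT hE (chart_dom_fat mS gA i) (sf i) n) => //.
by move=> [x w] [/= ix _]; rewrite -(tangent_mapE mS gA).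
Qed.

End charts.

(** * Convergence of iterated tangent maps *)

Section manifold_topology.
Context {R : realType}.
Implicit Types V W E : preTopologicalLmodType R.

Section mfd_charts.
Context {T : Type} {V : preTopologicalLmodType R}.
Variables (S : set V) (A : atlas T V).
Hypothesis mS : model_set S.
Hypothesis gA : good_atlas S A.

Lemma chart_domS (i : chart_index A) p : dom i p -> S (chart i p).
Proof.
move=> ip; have [Q _ e] := chart_dom_open gA i.
suff : (Q `&` S) (chart i p) by case.
by rewrite -e; exists p.
Qed.

Lemma mfd_nbhs_chart (i : chart_index A) (p : T) (N : set V) :
  dom i p -> nbhs (chart i p) N ->
  nbhs (p : mfd A) [set q | dom i q /\ N (chart i q)].
Proof.
move=> ip nN.
have oQ : open ([set q | dom i q /\ N° (chart i q)] : set (mfd A)).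
  move=> j; have [Q oQ e] := good_open gA j i.
  (* An implication, because the change of charts is meaningful only on the overlap: continuity
     relative to [S] then gives a neighbourhood in the whole of [V]. *)
  pose P z := (Q `&` S) z -> N° (chart i (chart_inv j z)).
  have trc := Cn_cont (good_trans gA j i 0%N); rewrite e in trc.
  exists (Q `&` P°); first exact: openI oQ (open_interior _).
  move=> q jq; split=> [[iq Nq]|[Qq Pq]].
    have Qq : (Q `&` S) (chart j q) by rewrite -e; exists q.
    have trq : (chart i \o chart_inv j) @ within (Q `&` S) (nbhs (chart j q))
      -->
        chart i q.
      have -> : chart i q = (chart i \o chart_inv j) (chart j q).
        by rewrite /= (good_inv gA).
      exact: cont_on_within trc Qq.
    split; first exact: Qq.1.
    exact: (trq _ (nbhs_interior Nq)).
  have QS : (Q `&` S) (chart j q) by split => //; exact: chart_domS.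
  have [r [jr ir] rq] : (chart j @` (dom j `&` dom i)) (chart j q) by rewrite e.
  have qr : q = r by rewrite -(good_inv gA jq) -rq (good_inv gA).
  split; first by rewrite qr.
  by have := interior_subset Pq QS; rewrite (good_inv gA).
apply: filterS (open_nbhs_nbhs (conj oQ (conj ip nN))) =>
  q [iq /interior_subset].
by [].
Qed.

Lemma cvg_chart_inv X (F : set_system X) (i : chart_index A) (a : X -> V) x :
  Filter F -> chart_dom i x -> a @ F --> x -> (\forall k \near F,
    chart_dom i (a k)) ->
  (fun k => chart_inv i (a k) : mfd A) @ F --> (chart_inv i x : mfd A).
Proof.
move=> FF ix ax ia U; rewrite nbhsE => -[B [oB Bx] BU].
have [W oW BW] := oB i; have [ip px] := chart_domP gA ix.
have Wx : W x by rewrite -px; apply/BW.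
have Wa : \forall k \near F, W (a k) by apply: ax; exact: open_nbhs_nbhs.
apply: filterS2 ia Wa => k /(chart_domP gA)[ik pk] Wk.
by apply: BU; apply/BW => //; rewrite pk.
Qed.

Lemma csm_on_continuous E (f : T -> E) : csm_on A f ->
  continuous (f : mfd A -> E).
Proof.
move=> sf p N nN; rewrite nbhs_simpl /=.
pose c := chart_at A p; have cp : dom c p by exact: (good_at gA).
have fc : (f \o chart_inv c) @ within (chart_dom c) (nbhs (chart c p)) --> f p.
  have -> : f p = (f \o chart_inv c) (chart c p) by rewrite /= (good_inv gA).
  by apply: cont_on_within (Cn_cont (sf c 0%N)) _; exists p.
have := mfd_nbhs_chart cp (fc _ nN); apply: (@filterS _ (nbhs (p : mfd A))).
move=> q [cq /= h]; rewrite -[q](good_inv gA cq); apply: h; by exists q.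
Qed.

(** Continuous convergence: parameter and point move together. It can be tested in charts and
    composes freely, and the next two lemmas relate it to the compact-open topology. *)
Definition cvg0 E X (D : set V) (F : set_system X) (G : X -> V -> E) (G0 : V ->
  E) :=
  forall Y (H : set_system Y) (xi : Y -> X) (y : Y -> V) y0, Filter H -> D y0 ->
    xi @ H --> F -> y @ H --> y0 -> (\forall k \near H, D (y k)) ->
    (fun k => G (xi k) (y k)) @ H --> G0 y0.

(** At each point of the compact set, joint convergence gives a neighbourhood and a set of
    parameters that work together; this is the near-covering form of compactness. *)
Lemma cvg0_compact_open E X (F : set_system X) (g : X -> T -> E) (g0 : T -> E) :
  Filter F ->
  (forall i : chart_index A, cvg0 (chart_dom i) F
     (fun k => g k \o chart_inv i) (g0 \o chart_inv i)) ->
  (g : X -> {compact-open, mfd A -> E}) @ F --> (g0 : {compact-open, mfd A ->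
    E}).
Proof.
move=> FF h; apply/compact_open_cvgP => K O cK oO gK.
suff : \forall k \near F, K `<=` [set p | O (g k p)].
  by apply: (@filterS _ F) => k Kk _ [p Kp <-]; exact: Kk.
have /compact_near_coveringP := cK.
apply=> p Kp; pose c := chart_at A p; have cp : dom c p by exact: (good_at gA).
have cdp : chart_dom c (chart c p) by exists p.
have Op : nbhs (g0 p) O by apply: open_nbhs_nbhs; split => //; apply: gK;
  exists p.
have gp : g0 p = (g0 \o chart_inv c) (chart c p) by rewrite /= (good_inv gA).
rewrite gp in Op.
pose H := filter_prod (within (chart_dom c) (nbhs (chart c p))) F.
have HH : Filter H by exact: filter_prod_filter.
have f0 : snd @ H --> F by exact: cvg_snd.
have f1 : fst @ H --> chart c p.
  by apply: (cvg_trans (G := within (chart_dom c) (nbhs (chart c p))));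
    [exact: cvg_fst|exact: cvg_within].
have f2 : \forall k \near H, chart_dom c k.1.
  by exists (chart_dom c, setT); [split; [exact: withinT|exact: filterT]|move=>
    k []].
have [[N P] /= [nN nP] NP] := h c _ H snd fst (chart c p) HH cdp f0 f1 f2 _ Op.
exists ([set q | dom c q /\ (chart_dom c (chart c q) -> N (chart c q))], P) =>
  /=.
  by split => //; exact: (mfd_nbhs_chart cp nN).
move=> [q k] [/= [cq Nq] Pk].
have := NP (chart c q, k); rewrite /= (good_inv gA)//; apply; split => //.
by apply: Nq; exists q.
Qed.

(** Local compactness gives a compact neighbourhood [K] of [y0] on which the limit already has
    values in the given open set. Its part in the closed set [S] is compact and is carried by the
    chart to a compact subset of the manifold, against which compact-open convergence is tested. *)
Lemma compact_open_cvg0 E X (F : set_system X) (g : X -> T -> E) (g0 : T -> E)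
    (i : chart_index A) :
  Filter F -> csm_on A g0 ->
  (g : X -> {compact-open, mfd A -> E}) @ F --> (g0 : {compact-open, mfd A ->
    E}) ->
  cvg0 (chart_dom i) F (fun k => g k \o chart_inv i) (g0 \o chart_inv i).
Proof.
move=> FF sg0 /compact_open_cvgP h Y H xi y y0 HH iy0 xiF yy0 iy N nN.
have [Q oQ e] := chart_dom_open gA i.
have g0c : (g0 \o chart_inv i) @ within (chart_dom i) (nbhs y0) -->
  (g0 \o chart_inv i) y0.
  exact: cont_on_within (Cn_cont (sg0 i 0%N)) iy0.
have := g0c _ (nbhs_interior nN); rewrite /= nbhs_simpl /within /= => nP.
have Qy0 : nbhs y0 Q by apply: open_nbhs_nbhs; move: iy0; rewrite e => -[].
have [K [cK nK KP]] := model_locally_compact mS (filterI Qy0 nP).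
have cL : compact ((fun z => chart_inv i z : mfd A) @` (K `&` S)).
  apply: continuous_compact.
    apply/subspace_continuousP => x [Kx Sx].
    have D0 z : (K `&` S) z -> chart_dom i z by rewrite e => -[/KP[]].
    apply: (cvg_chart_inv (a := id)); [exact: D0|exact: cvg_within|].
    by apply: filterS (withinT _ _) => z /D0.
  exact: compact_closedI cK (model_closed mS).
have F1 : F [set k | g k @` ((fun z => chart_inv i z : mfd A) @` (K `&` S))
  `<=` N°].
  apply: (h _ N° cL (@open_interior _ N)).
  move=> _ [_ [z [Kz Sz] <-] <-]; have [Qz] := KP _ Kz; apply.
  by rewrite e; split.
have H1 : \forall k \near H, g (xi k) @` ((fun z => chart_inv i z : mfd A)
  @` (K `&` S)) `<=` N°.
  exact: (xiF _ F1).
have H2 : \forall k \near H, K (y k) by exact: (yy0 _ nK).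
apply: filterS3 H1 H2 iy => k gk Ky; rewrite e => -[_ Sy].
by apply: interior_subset; apply: gk; exists (chart_inv i (y k)) => //;
  exists (y k).
Qed.

End mfd_charts.

(* Joint convergence of the families T^k (G x) to T^k G0. *)
Fixpoint convT (k : nat) V E X (D : set V) (F : set_system X) (G : X -> V -> E)
    (G0 : V -> E) : Prop :=
  if k is m.+1 then
    convT m (D `*` setT) F (fun x => locT D (G x)) (locT D G0)
  else cvg0 D F G G0.

Lemma convT_eq k V E X (D : set V) (F : set_system X) (G G' : X -> V -> E)
    (G0 G0' : V -> E) :
  Filter F -> hausdorff_space E -> fat D -> Csm D G0 ->
  (\forall x \near F, Csm D (G x)) ->
  (\forall x \near F, forall y, D y -> G x y = G' x y) ->
  (forall y, D y -> G0 y = G0' y) ->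
  convT k D F G G0 -> convT k D F G' G0'.
Proof.
move=> FF; elim: k V E D G G' G0 G0' =>
  [|k IH] V E D G G' G0 G0' hE fD sG0 sG e e0 /=.
  move=> h Y H xi y y0 HH Dy0 xiF yy0 Dy; rewrite -e0//.
  apply: cvg_eq_near (h Y H xi y y0 HH Dy0 xiF yy0 Dy).
  have eH : \forall k \near H, forall z, D z -> G (xi k) z = G' (xi k) z.
    exact: (xiF _ e).
  by apply: filterS2 eH Dy => k h'; exact: h'.
apply: IH.
- exact: prod_hausdorff.
- exact: fat_setXT fD.1 fD.
- exact: Csm_locT.
- by apply: filterS sG => x; exact: Csm_locT.
- apply: filterS2 sG e => x sGx ex [y v] [/= Dy _]; exact: locT_eq.
- move=> [y v] [/= Dy _]; exact: locT_eq.
Qed.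

(** Both recursions peel off the innermost tangent functor, so the induction runs over all
    manifolds: the step passes to [tangent_atlas] and [tangent_map], whose chart expression is
    [locT]. *)
Lemma convT_iter_tangent k T V (S : set V) (A : atlas T V)
  E X (F : set_system X)
    (g : X -> T -> E) (g0 : T -> E) :
  Filter F -> model_set S -> good_atlas S A -> hausdorff_space E ->
  (forall x, csm_on A (g x)) -> csm_on A g0 ->
  (forall i : chart_index A, convT k (chart_dom i) F
     (fun x => g x \o chart_inv i) (g0 \o chart_inv i)) ->
  ((fun x => iter_tangent_map (n := k) A (g x)) :
     X -> {compact-open, mfd (iter_tangent_atlas k A) -> iter_double k E})
       @ F -->
  (iter_tangent_map (n := k) A g0 :
     {compact-open, mfd (iter_tangent_atlas k A) -> iter_double k E}).
Proof.
move=> FF; elim: k T V S A E g g0 => [|k IH] T V S A E g g0 mS gA hE sg sg0 h.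
  exact: cvg0_compact_open gA _ _ _ _ _ _ h.
apply: (IH _ _ _ (tangent_atlas A)); first exact: model_setXT mS.
- exact: good_tangent_atlas.
- exact: prod_hausdorff.
- by move=> x; exact: csm_on_tangent mS gA hE (sg x).
- exact: csm_on_tangent mS gA hE sg0.
move=> i; have fi := chart_dom_fat mS gA i.
rewrite /chart_dom (tangent_chart_dom mS gA).
have hi : convT k (chart_dom (A := A) i `*` setT) F
    (fun x => locT (chart_dom (A := A) i) (g x \o chart_inv (a := A) i))
    (locT (chart_dom (A := A) i) (g0 \o chart_inv (a := A) i)) := h i.
apply: (convT_eq _ _ _ _ _ _ _ hi).
- exact: prod_hausdorff.
- exact: fat_setXT fi.1 fi.
- exact: Csm_locT hE fi (sg0 i).
- by apply: nearW => x; exact: Csm_locT hE fi (sg x i).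
- by apply: nearW => x [y v] [/= Dy _]; rewrite -(tangent_mapE mS gA).
- by move=> [y v] [/= Dy _]; rewrite -(tangent_mapE mS gA).
Qed.

Lemma iter_tangent_convT k T V (S : set V) (A : atlas T V)
  E X (F : set_system X)
    (g : X -> T -> E) (g0 : T -> E) :
  Filter F -> model_set S -> good_atlas S A -> hausdorff_space E ->
  (forall x, csm_on A (g x)) -> csm_on A g0 ->
  (forall n, ((fun x => iter_tangent_map (n := n) A (g x)) :
     X -> {compact-open, mfd (iter_tangent_atlas n A) -> iter_double n E})
       @ F -->
  (iter_tangent_map (n := n) A g0 :
     {compact-open, mfd (iter_tangent_atlas n A) -> iter_double n E})) ->
  forall i : chart_index A, convT k (chart_dom i) F
     (fun x => g x \o chart_inv i) (g0 \o chart_inv i).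
Proof.
move=> FF; elim: k T V S A E g g0 => [|k IH] T V S A E g g0 mS gA hE sg sg0 h i.
  exact: compact_open_cvg0 mS gA _ _ _ _ _ _ _ _ (h 0%N).
have fi := chart_dom_fat mS gA i.
have /= := IH _ _ _ (tangent_atlas A) _ (fun x => tangent_map A (g x))
  (tangent_map A g0) (model_setXT mS) (good_tangent_atlas mS gA)
  (prod_hausdorff hE hE) (fun x => csm_on_tangent mS gA hE (sg x))
  (csm_on_tangent mS gA hE sg0) (fun n => h n.+1) i.
rewrite /chart_dom (tangent_chart_dom mS gA) => hi.
apply: convT_eq hi.
- exact: prod_hausdorff.
- exact: fat_setXT fi.1 fi.
- have := csm_on_tangent mS gA hE sg0 i.
  by rewrite /chart_dom (tangent_chart_dom mS gA).
- apply: nearW => x; have := csm_on_tangent mS gA hE (sg x) i.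
  by rewrite /chart_dom (tangent_chart_dom mS gA).
- by apply: nearW => x [y v] [/= Dy _]; rewrite -(tangent_mapE mS gA).
- by move=> [y v] [/= Dy _]; rewrite -(tangent_mapE mS gA).
Qed.

End manifold_topology.

(** * Smooth families of functions *)

Section parametrized_families.
Context {R : realType}.
Implicit Types V W E Z : preTopologicalLmodType R.

Lemma Cn_scaleD n V E (D : set V) (f g : V -> E) (c : R) : tvs_like E ->
  Cn n D f -> Cn n D g -> Cn n D (fun x => c *: f x + g x).
Proof.
move=> hE hf hg.
apply: (Cn_comp (D' := setT) (g := fun z : E * E => c *: z.1 + z.2)
  (f := fun x => (f x, g x))) => //; last exact: Cn_pair.
apply: Cn_lin => [x v t|x].
  by rewrite /= !scalerDr !scalerA [c * t]mulrC addrACA.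
have x1 := cvg_fst_comp (@cvg_id _ (nbhs x)).
have x2 := cvg_snd_comp (@cvg_id _ (nbhs x)).
by apply: tvs_cvgD => //; apply: tvs_cvgZ => //; exact: cvg_cst.
Qed.

Lemma Csm_scaleD V E (D : set V) (f g : V -> E) (c : R) : tvs_like E ->
  Csm D f -> Csm D g -> Csm D (fun x => c *: f x + g x).
Proof. by move=> hE sf sg n; exact: Cn_scaleD. Qed.

Lemma strict_scaleD V E (D : set V) (f g : V -> E) (x v : V) (l m : E) (c : R) :
  tvs_like E -> strict_derive D f x v l -> strict_derive D g x v m ->
  strict_derive D (fun x => c *: f x + g x) x v (c *: l + m).
Proof.
move=> hE hf hg X F a b t FF ax bv t0 Dab.
have hf' := hf X F a b t FF ax bv t0 Dab; have hg' :=
  hg X F a b t FF ax bv t0 Dab.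
apply: cvg_eq_near (tvs_cvgD hE (tvs_cvgZ hE (cvg_cst c) hf') hg');
  apply: nearW => k; rewrite /quot.
by rewrite scalerA mulrC -scalerA -scalerDr scalerBr opprD [in RHS]addrACA.
Qed.

Lemma locT_scaleD V E (D : set V) (f g : V -> E) (c : R) p : lcs E -> fat D ->
  Csm D f -> Csm D g -> D p.1 ->
  locT D (fun x => c *: f x + g x) p = c *: locT D f p + locT D g p.
Proof.
move=> lE fD sf sg Dp; have hE := lcs_hausdorff lE.
rewrite /locT; congr (_, _); rewrite /=; apply: dmapE => //.
  exact: Csm_scaleD (lcs_tvs lE) sf sg.
apply: strict_scaleD; first exact: lcs_tvs.
- exact: (Csm_dmap hE fD sf).1.
- exact: (Csm_dmap hE fD sg).1.
Qed.

Lemma convT_scaleD k V E X (D : set V) (F : set_system X) (G H : X -> V -> E)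
    (G0 H0 : V -> E) (c : X -> R) (c0 : R) :
  Filter F -> lcs E -> fat D -> (forall x, Csm D (G x)) -> (forall x,
    Csm D (H x)) ->
  Csm D G0 -> Csm D H0 -> c @ F --> c0 ->
  convT k D F G G0 -> convT k D F H H0 ->
  convT k D F (fun x y => c x *: G x y + H x y) (fun y => c0 *: G0 y + H0 y).
Proof.
move=> FF; elim: k V E D G H G0 H0 =>
  [|k IH] V E D G H G0 H0 lE fD sG sH sG0 sH0 cc.
  move=> hG hH Y K xi y y0 HK Dy0 xiF yy0 Dy; have hE := lcs_tvs lE.
  apply: tvs_cvgD => //; last exact: hH.
  by apply: tvs_cvgZ => //; [exact: cvg_comp cc|exact: hG].
have hE := lcs_hausdorff lE; have hE' := lcs_tvs lE.
move=> hG hH /=.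
have h := IH _ _ (D `*` setT) (fun x => locT D (G x)) (fun x => locT D (H x))
  (locT D G0) (locT D H0) (lcs_prod lE lE) (fat_setXT fD.1 fD)
  (fun x => Csm_locT hE fD (sG x)) (fun x => Csm_locT hE fD (sH x))
  (Csm_locT hE fD sG0) (Csm_locT hE fD sH0) cc hG hH.
apply: (convT_eq _ _ _ _ _ _ _ h).
- exact: prod_hausdorff.
- exact: fat_setXT fD.1 fD.
- by apply: Csm_scaleD; [exact: tvs_like_prod|exact: Csm_locT|exact: Csm_locT].
- apply: nearW => x.
  by apply: Csm_scaleD; [exact: tvs_like_prod|exact: Csm_locT|exact: Csm_locT].
- by apply: nearW => x [y v] [/= Dy _]; rewrite locT_scaleD.
- by move=> [y v] [/= Dy _]; rewrite locT_scaleD.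
Qed.

Lemma setTX_interior V W (D : set W) (z : V * W) :
  ([set: V] `*` D)° z -> D° z.2.
Proof.
case=> -[A B] [/= nA nB] AB; rewrite /interior.
by apply: filterS nB => x Bx; have [] := AB (z.1, x) (conj (nbhs_singleton nA)
  Bx).
Qed.

(** The derivative at (f, y) in direction (u, v) is that of [L f] at [y] along [v], plus [L u y] by
    linearity. Both terms are evaluations again, of the tangent family and of [L] itself, so the
    induction is over all families [L]. In the application the last hypothesis is where local
    compactness of M enters. *)
Lemma evaluation_Cn n Z V E (D : set V) (L : Z -> V -> E) :
  tvs_like Z -> lcs E -> fat D -> (forall f, Csm D (L f)) ->
  (forall f u (t : R) y, D y -> L (f + t *: u) y = L f y + t *: L u y) ->
  (forall k f, convT k D (nbhs f) L (L f)) ->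
  Cn n ([set: Z] `*` D) (fun p => L p.1 p.2).
Proof.
move=> hZ; elim: n V E D L => [|n IH] V E D L lE fD sL linL cL.
  split=> // X F a x FF [_ /= Dx] ax Da.
  apply: (cL 0%N x.1) => //; [exact: cvg_fst_comp|exact: cvg_snd_comp|].
  by apply: filterS Da => k [].
have hE := lcs_hausdorff lE; have hE' := lcs_tvs lE.
have Lc : cont_on ([set: Z] `*` D) (fun p => L p.1 p.2).
  move=> X F a x FF [_ /= Dx] ax Da.
  apply: (cL 0%N x.1) => //; [exact: cvg_fst_comp|exact: cvg_snd_comp|].
  by apply: filterS Da => k [].
split=> //.
pose dL (p : (Z * V) * (Z * V)) : E :=
  (locT D (L p.1.1) (p.1.2, p.2.2)).2 + L p.2.1 p.1.2.
have fZ : fat [set: Z] by apply: open_fat => //; exact: openT.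
exists dL.
  apply: gateaux_strict => //; first exact: fat_setX.
    move=> X F a x FF [[_ /= Dx] _] ax Da.
    have a1 := cvg_fst_comp ax; have a2 := cvg_snd_comp ax.
    have Da2 : \forall k \near F, D (a k).1.2 by apply: filterS Da => k [[]].
    apply: tvs_cvgD => //.
      have h : (fun k => locT D (L (a k).1.1) ((a k).1.2, (a k).2.2)) @ F -->
          locT D (L x.1.1) (x.1.2, x.2.2).
        apply: (cL 1%N x.1.1 X F (fun k => (a k).1.1)
          (fun k => ((a k).1.2, (a k).2.2))) => //.
        + exact: (cvg_fst_comp a1).
        + apply: cvg_pair_nbhs;
            [exact: (cvg_snd_comp a1)|exact: (cvg_snd_comp a2)].
        + by apply: filterS Da2.
      exact: (cvg_snd_comp h).
    apply: (cL 0%N x.2.1) => //;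
      [exact: (cvg_fst_comp a2)|exact: (cvg_snd_comp a1)].
  move=> [f y] [u v] /setTX_interior /= Dy.
  have c1 := strict_line fD.1 Dy ((Csm_dmap hE fD (sL f)).1 y v
    (interior_subset Dy)).
  have c2 : (fun h : R => L u (y + h *: v)) @ (0 : R)^' --> L u y.
    apply: (cL 0%N u _ (0 : R)^' (fun=> u)).
    + exact: interior_subset.
    + exact: cvg_cst.
    + by apply: cvg_within_filter; apply: cvg_line0; exact: fD.1.
    + by apply: cvg_within; apply: near_line_interior => //; exact: fD.1.
  apply: cvg_eq_near (tvs_cvgD hE' c1 c2); near=> h.
  have h0 : h != 0 by near: h; exact: nbhs_dnbhs_neq.
  have Dh : D (y + h *: v).
    by near: h; apply: cvg_within; apply: near_line_interior => //; exact: fD.1.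
  rewrite linL// -[L u _ in LHS]scale1r -(mulVf h0) -scalerA -scalerDr.
  by congr (_ *: _); rewrite addrAC.
have dLE : forall p, (([set: Z] `*` D) `*` setT) p ->
    1 *: (locT D (L p.1.1) (p.1.2, p.2.2)).2 + L p.2.1 p.1.2 = dL p.
  by move=> p _; rewrite scale1r.
apply: (Cn_sub (fun _ h => h) dLE); apply: Cn_scaleD => //; last first.
  apply: (Cn_comp (D' := [set: Z] `*` D) (g := fun p => L p.1 p.2)
    (f := fun p : (Z * V) * (Z * V) => (p.2.1, p.1.2))).
  - by move=> p [[_ Dp] _].
  - exact: IH.
  - apply: Cn_pair.
      by apply: (Cn_comp (D' := setT) (g := fst) (f := snd)) => //;
        [exact: Cn_fst|exact: Cn_snd].
    by apply: (Cn_comp (D' := setT) (g := snd) (f := fst)) => //;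
      [exact: Cn_snd|exact: Cn_fst].
apply: (Cn_comp (D' := setT) (g := snd)
  (f := fun p : (Z * V) * (Z * V) => locT D (L p.1.1) (p.1.2, p.2.2))) => //.
  exact: Cn_snd.
apply: (Cn_comp (D' := [set: Z] `*` (D `*` [set: V]))
  (g := fun p => locT D (L p.1) p.2)
  (f := fun p : (Z * V) * (Z * V) => (p.1.1, (p.1.2, p.2.2)))).
- by move=> p [[_ Dp] _].
- apply: (IH _ _ (D `*` [set: V]) (fun f => locT D (L f))).
  + exact: lcs_prod.
  + exact: fat_setXT fD.1 fD.
  + by move=> f; exact: Csm_locT.
  + move=> f u t [y v] [/= Dy _].
    rewrite [RHS]addrC -locT_scaleD//; apply: locT_eq => //.
    by move=> z Dz; rewrite linL// addrC.
  + by move=> k f; exact: (cL k.+1 f).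
- apply: Cn_pair; last apply: Cn_pair.
  + by apply: (Cn_comp (D' := setT) (g := fst) (f := fst)) => //; exact: Cn_fst.
  + by apply: (Cn_comp (D' := setT) (g := snd) (f := fst)) => //;
      [exact: Cn_snd|exact: Cn_fst].
  + by apply: (Cn_comp (D' := setT) (g := snd) (f := snd)) => //; exact: Cn_snd.
Unshelve. all: by end_near. Qed.

Section partial_derivatives.
Context {Z V E : preTopologicalLmodType R}.
Variables (O : set Z) (D : set V) (G : Z * V -> E).
Hypotheses (hZ : tvs_like Z) (oO : open O) (fD : fat D) (lE : lcs E).
Hypothesis sG : Csm (O `*` D) G.

Lemma fat_openX : fat (O `*` D).
Proof. by apply: fat_setX => //; exact: open_fat. Qed.

Lemma Csm_slice z : O z -> Csm D (fun y => G (z, y)).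
Proof.
move=> Oz n; apply: (Cn_comp (D' := O `*` D)) (sG n) _ => //.
apply: Cn_pair; first exact: Cn_cst.
by apply: Cn_lin => // x; exact: cvg_id.
Qed.

Lemma derive_slice z y v : O z -> D y ->
  derive_within D (fun y => G (z, y)) y v = dmap (O `*` D) G ((z, y), (0, v)).
Proof.
move=> Oz Dy; have hE := lcs_hausdorff lE.
apply: dmapE => //; first exact: Csm_slice.
have h := (Csm_dmap hE fat_openX sG).1 (z, y) (0, v) (conj Oz Dy).
move=> X F a b t FF ay bv t0 Dab.
have := h X F (fun k => (z, a k)) (fun k => (0, b k)) t FF.
move=> h1; apply: cvg_eq_near (h1 _ _ t0 _).
- by apply: nearW => k; rewrite /quot pair_line scaler0 addr0.
- by apply: cvg_pair_nbhs => //; exact: cvg_cst.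
- by apply: cvg_pair_nbhs => //; exact: cvg_cst.
- apply: filterS Dab => k [? ? ?]; rewrite pair_line scaler0 addr0.
  by split.
Qed.

(** The tangent map in the second variable alone, with the first as parameter. It is a smooth family
    again ([Csm_sliceT]), which allows induction on the order of the tangent map. *)
Definition sliceT (p : Z * (V * V)) : E * E :=
  (G (p.1, p.2.1), dmap (O `*` D) G ((p.1, p.2.1), (0, p.2.2))).

Lemma sliceTE z p : O z -> D p.1 ->
  locT D (fun y => G (z, y)) p = sliceT (z, p).
Proof. by move=> Oz Dp; rewrite /locT /sliceT derive_slice. Qed.

Lemma Csm_pairing W W' W'' (D' : set W) (f : W -> W') (g : W -> W'') :
  Csm D' f -> Csm D' g -> Csm D' (fun x => (f x, g x)).
Proof. by move=> hf hg n; exact: Cn_pair. Qed.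

Lemma Csm_sliceT : Csm (O `*` (D `*` setT)) sliceT.
Proof.
have c1 : Csm (O `*` (D `*` [set: V])) (fun p => (p.1, p.2.1)).
  apply: Csm_pairing => [n|n]; first exact: Cn_fst.
  by apply: (Cn_comp (D' := setT) (g := fst) (f := snd)) => //;
    [exact: Cn_fst|exact: Cn_snd].
apply: Csm_pairing.
  by apply: Csm_comp sG c1 => p [? []].
have [_ sdG] := Csm_dmap (lcs_hausdorff lE) fat_openX sG.
apply: (Csm_comp (f := fun p : Z * (V * V) => ((p.1, p.2.1), ((0, p.2.2)
  : Z * V)))) sdG _.
  by move=> p [? []].
apply: Csm_pairing => //; apply: Csm_pairing => n; first exact: Cn_cst.
by apply: (Cn_comp (D' := setT) (g := snd) (f := snd)) => //; exact: Cn_snd.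
Qed.

End partial_derivatives.

(** Replacing the family by its [sliceT] lowers the order, until only joint continuity remains to be
    checked. *)
Lemma convT_param k Z V E X (O : set Z) (D : set V) (G : Z * V -> E)
    (F : set_system X) (a : X -> Z) z :
  Filter F -> tvs_like Z -> open O -> fat D -> lcs E -> Csm (O `*` D) G ->
  O z -> a @ F --> z -> (\forall x \near F, O (a x)) ->
  convT k D F (fun x y => G (a x, y)) (fun y => G (z, y)).
Proof.
move=> FF hZ oO; elim: k V E D G => [|k IH] V E D G fD lE sG Oz az Oa.
  move=> Y H xi y y0 HH Dy0 xiF yy0 Dy.
  apply: (Cn_cont (sG 0%N)) => //.
    by apply: cvg_pair_nbhs => //; exact: cvg_comp az.
  have Ox : \forall k \near H, O (a (xi k)) by exact: (xiF _ Oa).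
  by apply: filterS2 Ox Dy.
have fD' := fat_setXT fD.1 fD.
have sT := Csm_sliceT hZ oO fD lE sG.
have h := IH _ _ (D `*` setT) (sliceT O D G) fD' (lcs_prod lE lE) sT Oz az Oa.
apply: (convT_eq _ _ _ _ _ _ _ h) => //.
- exact: prod_hausdorff (lcs_hausdorff lE) (lcs_hausdorff lE).
- exact: Csm_slice sT _ Oz.
- by apply: filterS Oa => x; exact: Csm_slice sT _.
- by apply: filterS Oa => x Ox [y v] [/= Dy _];
    rewrite (sliceTE hZ oO fD lE sG).
- by move=> [y v] [/= Dy _]; rewrite (sliceTE hZ oO fD lE sG).
Qed.

(* Differentiating the parameter commutes with the tangent maps in the
   variable [y] by the symmetry of second derivatives. *)
Lemma convT_quot k Z V E X (O : set Z) (D : set V) (G : Z * V -> E)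
    (F : set_system X) (a b : X -> Z) (t : X -> R) z w :
  Filter F -> tvs_like Z -> open O -> fat D -> lcs E -> Csm (O `*` D) G ->
  O z -> a @ F --> z -> b @ F --> w -> t @ F --> (0 : R) ->
  (\forall x \near F, [/\ O (a x), O (a x + t x *: b x) & t x != 0]) ->
  convT k D F (fun x y => (t x)^-1 *: (G (a x + t x *: b x, y) - G (a x, y)))
    (fun y => dmap (O `*` D) G ((z, y), (w, 0))).
Proof.
move=> FF hZ oO; elim: k V E D G => [|k IH] V E D G fD lE sG Oz az bw t0 Oab;
  have fOD := fat_openX hZ oO fD; have hE := lcs_hausdorff lE.
  move=> Y H xi y y0 HH Dy0 xiF yy0 Dy.
  have := (Csm_dmap hE fOD sG).1 (z, y0) (w, 0) (conj Oz Dy0) Y H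
    (fun k => (a (xi k), y k)) (fun k => (b (xi k), 0)) (fun k => t (xi k)) HH.
  move=> h; apply: cvg_eq_near (h _ _ _ _).
  - by apply: nearW => k; rewrite /quot pair_line scaler0 addr0.
  - by apply: cvg_pair_nbhs => //; exact: cvg_comp az.
  - by apply: cvg_pair_nbhs; [exact: cvg_comp bw|exact: cvg_cst].
  - exact: cvg_comp t0.
  - have Ox : \forall k \near H, [/\ O (a (xi k)),
        O (a (xi k) + t (xi k) *: b (xi k)) & t (xi k) !=
          0] by exact: (xiF _ Oab).
    apply: filterS2 Ox Dy => i [? ? ?] ?; rewrite pair_line scaler0 addr0.
    by split.
have fD' := fat_setXT fD.1 fD; have hE' := lcs_tvs lE.
have sT := Csm_sliceT hZ oO fD lE sG.
have sq (c : R) z1 z2 : O z1 -> O z2 ->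
    Csm D (fun y => c *: (G (z1, y) - G (z2, y))).
  move=> O1 O2 n; apply: (Cn_sub (f := fun y => c *: G (z1, y) +
    ((- c) *: G (z2, y) + 0))) (fun _ h => h) _ _.
    by move=> y _; rewrite addr0 scaleNr scalerBr.
  apply: Cn_scaleD => //; first exact: Csm_slice sG _ O1 n.
  by apply: Cn_scaleD => //; [exact: Csm_slice sG _ O2 n|exact: Cn_cst].
have h := IH _ _ (D `*` setT) (sliceT O D G) fD' (lcs_prod lE lE)
  sT Oz az bw t0 Oab.
have hd := Csm_dmap hE fOD sG.
have hdd := Csm_dmap hE (fat_setXT fOD.1 fOD) hd.2.
have hEE : hausdorff_space (E * E)%type by exact: prod_hausdorff.
have fOT := fat_openX hZ oO fD'.
have hdT := Csm_dmap hEE fOT sT.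
have sq' (c : R) z1 z2 : O z1 -> O z2 -> Csm (D `*` setT)
    (fun p => c *: (sliceT O D G (z1, p) - sliceT O D G (z2, p))).
  move=> O1 O2 n; apply: (Cn_sub (f := fun p => c *: sliceT O D G (z1, p) +
    ((- c) *: sliceT O D G (z2, p) + 0))) (fun _ h => h) _ _.
    by move=> y _; rewrite addr0 scaleNr scalerBr.
  have hEE' := tvs_like_prod hE' hE'.
  apply: Cn_scaleD => //; first exact: Csm_slice sT _ O1 n.
  by apply: Cn_scaleD => //; [exact: Csm_slice sT _ O2 n|exact: Cn_cst].
(* By linearity, difference quotients in the parameter commute with the tangent map in [y]. *)
have locq (c : R) z1 z2 p : O z1 -> O z2 -> D p.1 ->
    c *: (sliceT O D G (z1, p) - sliceT O D G (z2, p)) =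
    locT D (fun y => c *: (G (z1, y) - G (z2, y))) p.
  move=> O1 O2 Dp; rewrite -!(sliceTE hZ oO fD lE sG)//.
  have s0 : Csm D (fun=> 0 : E) by move=> n; exact: Cn_cst.
  have s1 := Csm_slice hZ sG O1; have s2 := Csm_slice hZ sG O2.
  have s20 := Csm_scaleD (- c) hE' s2 s0.
  transitivity (locT D (fun y => c *: G (z1, y) + (- c *: G (z2, y) + 0)) p);
    last first.
    apply: locT_eq => //; first exact: Csm_scaleD.
    by move=> y _; rewrite addr0 scaleNr scalerBr.
  rewrite (locT_scaleD _ lE fD s1 s20 Dp) (locT_scaleD _ lE fD s2 s0 Dp).
  rewrite scalerBr -scaleNr; congr (_ + _); rewrite -[LHS]addr0; congr (_ + _).
  rewrite /locT; congr (_, _); apply/esym/dmapE => //.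
  move=> Y H a' b' t' *; apply: cvg_eq_near (cvg_cst (0 : E)).
  by apply: nearW => i; rewrite /quot subrr scaler0.
have c1 n : Cn n (D `*` [set: V])
    (fun p => ((z, p), ((w, 0) : Z * (V * V)))).
  apply: Cn_pair; last by apply: Cn_cst; apply: tvs_like_prod => //;
    apply: tvs_like_prod; exact: fD.1.
  apply: Cn_pair; first exact: Cn_cst.
  by apply: Cn_lin => // x; exact: cvg_id.
have c2 n : Cn n D (fun y => ((z, y), ((w, 0) : Z * V))).
  apply: Cn_pair; last by apply: Cn_cst; apply: tvs_like_prod => //;
    exact: fD.1.
  apply: Cn_pair; first exact: Cn_cst.
  by apply: Cn_lin => // x; exact: cvg_id.
have sdw : Csm D (fun y => dmap (O `*` D) G ((z, y), (w, 0))).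
  by move=> n; apply: (Cn_comp _ (hd.2 n) (c2 n)) => y Dy.
apply: (convT_eq _ _ _ _ _ _ _ h) => //.
- by move=> n; apply: (Cn_comp _ (hdT.2 n) (c1 n)) => y Dy.
- by apply: filterS Oab => x [? ? _]; exact: sq'.
- by apply: filterS Oab => x [? ? _] p [Dp _]; exact: locq.
move=> [y v] [/= Dy _].
have Ozy : (O `*` D) (z, y) by [].
(* The induction hypothesis has the parameter derivative of [sliceT] as its limit. Componentwise
   this is the derivative of [G] along [w] and the derivative along [w] of the partial derivative of
   [G] along [v]. *)
have d1 : strict_derive (O `*` (D `*` [set: V])) (sliceT O D G)
    (z, (y, v)) (w, 0) (dmap (O `*` D) G ((z, y), (w, 0)),
      dmap ((O `*` D) `*` setT) (dmap (O `*` D) G)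
        (((z, y), (0, v)), ((w, 0), (0, 0)))).
  move=> Y H a' b' t' HH aH bH tH Oab'.
  have a1 := cvg_fst_comp aH; have a2 := cvg_snd_comp aH.
  have b1 := cvg_fst_comp bH; have b2 := cvg_snd_comp bH.
  apply: (@cvg_eq_near _ _ _ _ (fun k =>
    (quot G ((a' k).1, (a' k).2.1) ((b' k).1, (b' k).2.1) (t' k),
     quot (dmap (O `*` D) G) (((a' k).1, (a' k).2.1), (0, (a' k).2.2))
       (((b' k).1, (b' k).2.1), (0, (b' k).2.2)) (t' k)))).
    by apply: nearW => i; rewrite /quot !pair_line scaler0 addr0.
  have a3 : (fun k => ((a' k).1, (a' k).2.1)) @ H --> (z, y).
    by apply: cvg_pair_nbhs => //; exact: (cvg_fst_comp a2).
  have b3 : (fun k => ((b' k).1, (b' k).2.1)) @ H --> ((w, 0) : Z * V).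
    by apply: cvg_pair_nbhs => //; exact: (cvg_fst_comp b2).
  apply: cvg_pair_nbhs.
    apply: (hd.1 (z, y) (w, 0) Ozy) => //.
    by apply: filterS Oab' => i [[? [? _]] [? [? _]] ?]; split => //; do ?split.
  apply: (hdd.1 ((z, y), (0, v)) ((w, 0), (0, 0))) => //.
  - apply: cvg_pair_nbhs => //; apply: cvg_pair_nbhs; first exact: cvg_cst.
    exact: (cvg_snd_comp a2).
  - apply: cvg_pair_nbhs => //; apply: cvg_pair_nbhs; first exact: cvg_cst.
    exact: (cvg_snd_comp b2).
  - by apply: filterS Oab' => i [[? [? _]] [? [? _]] ?]; split => //; do ?split.
have Ozyv : (O `*` (D `*` [set: V])) (z, (y, v)) by [].
have d2 := hdT.1 (z, (y, v)) (w, 0) Ozyv.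
rewrite (strict_unique hEE fOT Ozyv d2 d1).
suff e2 : derive_within D (fun y => dmap (O `*` D) G ((z, y), (w, 0))) y v =
    dmap ((O `*` D) `*` setT) (dmap (O `*` D) G) (((z, y), (0, v)), ((w, 0),
      0)).
  by rewrite /locT e2.
(* The required limit differentiates first along [w], then along [v]; symmetry brings the two orders
   together. *)
rewrite (dmap_sym (0, v) (w, 0) fOD lE sG Ozy).
apply: dmapE => // Y H a' b' t' HH aH bH tH Dab'.
have a1 : (fun k => ((z, a' k), ((w, 0) : Z * V))) @ H --> ((z, y), (w, 0)).
  apply: cvg_pair_nbhs; last exact: cvg_cst.
  by apply: cvg_pair_nbhs => //; exact: cvg_cst.
have b1 : (fun k => (((0, b' k) : Z * V), (0 : Z * V))) @ H --> ((0, v), 0).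
  apply: cvg_pair_nbhs; last exact: cvg_cst.
  by apply: cvg_pair_nbhs => //; exact: cvg_cst.
have Ozyw : ((O `*` D) `*` [set: Z * V]) ((z, y), (w, 0)) by [].
apply: cvg_eq_near (hdd.1 ((z, y), (w, 0)) ((0, v), 0)
  Ozyw Y H _ _ t' HH a1 b1 tH _).
  by apply: nearW => i; rewrite /quot !pair_line !scaler0 !addr0.
by apply: filterS Dab' => i [? ? ?]; rewrite !pair_line !scaler0 !addr0.
Qed.

End parametrized_families.

(** * The space of smooth functions *)

Section smooth_function_space.
Context {R : realType}.

Lemma nbhs_space_atlas (V : preTopologicalLmodType R) (p : V) (N : set V) :
  nbhs (p : mfd (space_atlas V)) N <-> nbhs p N.
Proof.
rewrite !nbhsE; split=> -[B [oB Bp] BN]; exists B => //; split=> //.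
  have [W oW BW] := oB tt; suff -> : (B : set V) = W by [].
  by apply/seteqP; split=> q /BW; apply.
by move=> i; exists B.
Qed.

Context {T : Type} {V : preTopologicalLmodType R} {E : tvsType R}.
Variables (S : set V) (A : atlas T V).
Hypotheses (mS : model_set S) (gA : good_atlas S A) (lE : lcs E).
Let hE : hausdorff_space E := lcs_hausdorff lE.

Lemma smooth_mapP (f : T -> E) : smooth_map A (space_atlas E) f <-> csm_on A f.
Proof.
split=> [[fc fs] i|sf].
  apply: smooth_on_Csm => //; first exact: chart_dom_fat mS gA i.
  by have := fs i tt; rewrite /= preimage_setT setIT.
split=> [p N /nbhs_space_atlas nN|i j].
  exact: (csm_on_continuous gA sf nN).
rewrite /= preimage_setT setIT.
by apply: Csm_smooth_on (sf i) => //; exact: chart_dom_fat mS gA i.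
Qed.

Lemma csm_on_smooth (f : 'Cinfty(A, E)) : csm_on A f.
Proof. by apply/smooth_mapP; have := smooth_valP f => /asboolP. Qed.

(** The topology of C^oo(M, E) enters the later arguments through this criterion. *)
Lemma Cinfty_cvgP X (F : set_system X) (g : X -> 'Cinfty(A, E)) (f : 'Cinfty(A,
  E)) :
  Filter F -> (g @ F --> f) <->
  (forall k (i : chart_index A), convT k (chart_dom i) F
    (fun x => g x \o chart_inv i) (f \o chart_inv i)).
Proof.
move=> FF; split=> [gf k|h].
  have := proj1 (cvg_initial (@smooth_jets R T V A E) g f FF) gf.
  move=> /(proj1 (cvg_prod_topology _ _ FF)) h.
  exact: (iter_tangent_convT k FF mS gA hE (fun x => csm_on_smooth (g x))
    (csm_on_smooth f) h).
apply: (proj2 (cvg_initial (@smooth_jets R T V A E) g f FF)).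
apply: (proj2 (cvg_prod_topology _ _ FF)) => k.
exact: (convT_iter_tangent FF mS gA hE (fun x => csm_on_smooth (g x))
  (csm_on_smooth f) (h k)).
Qed.

Lemma Cinfty_cvg_scaleD X (F : set_system X) (c : X -> R)
    (g h : X -> 'Cinfty(A, E)) (c0 : R) (g0 h0 : 'Cinfty(A, E)) : Filter F ->
  c @ F --> c0 -> g @ F --> g0 -> h @ F --> h0 ->
  (fun x => c x *: g x + h x) @ F --> c0 *: g0 + h0.
Proof.
move=> FF cc /Cinfty_cvgP gg /Cinfty_cvgP hh; apply/Cinfty_cvgP => k i.
have sf (f : 'Cinfty(A, E)) := csm_on_smooth f i.
have e (t : R) (f f' : 'Cinfty(A, E)) : (t *: f + f') \o chart_inv i =
    (fun y => t *: (f \o chart_inv i) y + (f' \o chart_inv i) y).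
  by apply/funext.
rewrite e (_ : (fun x => _) = (fun x y => c x *: (g x \o chart_inv i) y +
  (h x \o chart_inv i) y)); last by apply/funext => x; exact: e.
exact: (convT_scaleD FF lE (chart_dom_fat mS gA i) (fun x => sf (g x))
  (fun x => sf (h x)) (sf g0) (sf h0) cc (gg k i) (hh k i)).
Qed.

Lemma Cinfty_tvs_like : tvs_like 'Cinfty(A, E).
Proof.
split=> z; have z1 := cvg_fst_comp (@cvg_id _ (nbhs z));
  have z2 := cvg_snd_comp (@cvg_id _ (nbhs z)).
  have h := Cinfty_cvg_scaleD (nbhs_filter z)
    (@cvg_cst _ (1 : R) _ (nbhs z) (nbhs_filter z)) z1 z2.
  rewrite scale1r in h; apply: cvg_eq_near h; apply: nearW => x.
  by rewrite scale1r.
have h := Cinfty_cvg_scaleD (nbhs_filter z) z1 z2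
  (@cvg_cst _ (0 : 'Cinfty(A, E)) _ (nbhs z) (nbhs_filter z)).
rewrite addr0 in h; apply: cvg_eq_near h; apply: nearW => x.
by rewrite addr0.
Qed.

Lemma cvg_Cinfty_eval X (F : set_system X) (g : X -> 'Cinfty(A, E))
    (f : 'Cinfty(A, E)) m : Filter F -> g @ F --> f ->
  (fun x => g x m) @ F --> f m.
Proof.
move=> FF /Cinfty_cvgP/(_ 0%N (chart_at A m)) h.
have cm := good_at gA m.
have := h _ F id (fun=> chart (chart_at A m) m) (chart (chart_at A m) m).
rewrite /= (good_inv gA)//; apply => //; [by exists m|exact: cvg_cst|].
by apply: nearW => x; exists m.
Qed.

(** Point evaluations are continuous and separate functions. *)
Lemma Cinfty_hausdorff : hausdorff_space 'Cinfty(A, E).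
Proof.
move=> f g fg; apply: val_inj; apply/funext => m; apply: hE => P Q nP nQ.
have ev (h : 'Cinfty(A, E)) := cvg_Cinfty_eval (g := id) (m := m)
  (nbhs_filter h) (@cvg_id _ (nbhs h)).
have [|h [Ph Qh]] := fg (fun f => P (f m)) (fun f => Q (f m)) (ev f P nP).
  exact (ev g Q nQ).
by exists (h m).
Qed.

(* The junk value 0 is taken when f is not smooth. *)
Definition to_Cinfty (f : T -> E) : 'Cinfty(A, E) :=
  if pselect (f \in smooth_pred A (E := E)) is left sf then SmoothFun sf else 0.

Lemma to_CinftyE (f : T -> E) : csm_on A f -> to_Cinfty f = f :> (T -> E).
Proof.
move=> sf; rewrite /to_Cinfty; case: pselect => // -[].
by apply/asboolP/smooth_mapP.
Qed.

(** Continuity is [convT_param], differentiability [convT_quot]. The derivative is a family of the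
    same kind with parameters in the product of [O] and [Z], to which the induction applies. *)
Lemma exponential_Cn n (Z : preTopologicalLmodType R) (O : set Z)
    (f : Z -> 'Cinfty(A, E)) : tvs_like Z -> open O ->
  (forall i : chart_index A,
    Csm (O `*` chart_dom i) (fun p => f p.1 (chart_inv i p.2))) ->
  Cn n O f.
Proof.
elim: n Z O f => [|n IH] Z O f hZ oO sf.
  split=> // X F a z FF Oz az Oa; apply/Cinfty_cvgP => k i.
  exact: (convT_param k FF hZ oO (chart_dom_fat mS gA i) lE (sf i) Oz az Oa).
have fd i := chart_dom_fat mS gA i.
have fOD i := fat_openX hZ oO (fd i).
have fcont : cont_on O f.
  move=> X F a z FF Oz az Oa; apply/Cinfty_cvgP => k i.
  exact: (convT_param k FF hZ oO (fd i) lE (sf i) Oz az Oa).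
split => //.
(* Taken pointwise on M, hence independent of charts; [DfE] identifies it in each chart with a
   partial derivative of the local expression. *)
pose Df (p : Z * Z) (m : T) := dir_derive (fun z => f z m) p.1 p.2.
have DfE z w (i : chart_index A) y : O z -> chart_dom i y -> Df (z, w)
  (chart_inv i y) =
    dmap (O `*` chart_dom i) (fun p => f p.1 (chart_inv i p.2)) ((z, y), (w,
      0)).
  move=> Oz iy; apply: dir_deriveE => //.
  have h := (Csm_dmap hE (fOD i) (sf i)).1 (z, y) (w, 0) (conj Oz iy).
  have nO : \forall h \near (0 : R)^', O (z + h *: w).
    apply: cvg_within; apply: near_line_interior => //.
    exact: open_nbhs_nbhs.
  apply: cvg_eq_near (h _ (0 : R)^' (fun=> (z, y)) (fun=> (w, 0)) id _ _ _ _ _).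
  - by apply: nearW => t; rewrite /quot pair_line scaler0 addr0.
  - exact: cvg_cst.
  - exact: cvg_cst.
  - exact: cvg_within.
  - near=> t; rewrite pair_line scaler0 addr0; split.
    + by split.
    + by split => //=; near: t.
    + by near: t; exact: nbhs_dnbhs_neq.
have sDf z w : O z -> csm_on A (Df (z, w)).
  move=> Oz i k.
  apply: (Cn_sub (fun _ h => h) (fun y iy => esym (DfE z w i y Oz iy))).
  apply: (Cn_comp (D' := (O `*` chart_dom i) `*` setT)
    (f := fun y => ((z, y), (w, 0))) _ ((Csm_dmap hE (fOD i) (sf i)).2 k)).
    by move=> y iy.
  have hV : tvs_like V := lcs_tvs (model_lcs mS).
  apply: Cn_pair; last by apply: Cn_cst; exact: tvs_like_prod.
  by apply: Cn_pair; [exact: Cn_cst|apply: Cn_lin => // x; exact: cvg_id].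
exists (fun p => to_Cinfty (Df p)).
  move=> z w Oz X F a b t FF az bw t0 Oab; apply/Cinfty_cvgP => k i.
  have h := convT_quot k FF hZ oO (fd i) lE (sf i) Oz az bw t0 Oab.
  have hV : tvs_like V := lcs_tvs (model_lcs mS).
  apply: (convT_eq FF hE (fd i) _ _ _ _ h).
  - move=> m; apply: (Cn_sub (fun _ h => h) (fun y iy => DfE z w i y Oz iy)).
    exact: sDf.
  - by apply: nearW => x; exact: (csm_on_smooth (quot f (a x) (b x) (t x))).
  - by apply: nearW => x y iy.
  - by move=> y iy; rewrite /= to_CinftyE ?DfE//; exact: sDf.
apply: IH.
- exact: tvs_like_prod.
- exact: open_setX openT.
- move=> i k.
  have e (p : (Z * Z) * V) : ((O `*` [set: Z]) `*` chart_dom i) p ->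
      dmap (O `*` chart_dom i) (fun p => f p.1 (chart_inv i p.2))
        ((p.1.1, p.2), (p.1.2, 0)) = to_Cinfty (Df p.1) (chart_inv i p.2).
    move=> [[/= Oz _] iy]; rewrite to_CinftyE; last by case: p.1 Oz => *;
      exact: sDf.
    by case: p.1 Oz => z w /= Oz; rewrite DfE.
  apply: (Cn_sub (fun _ h => h) e).
  apply: (Cn_comp (D' := (O `*` chart_dom i) `*` setT)
    (f := fun p : (Z * Z) * V => ((p.1.1, p.2), (p.1.2, 0)))
    _ ((Csm_dmap hE (fOD i) (sf i)).2 k)).
    by move=> p [[Oz _] iy].
  have hV : tvs_like V := lcs_tvs (model_lcs mS).
  apply: Cn_pair; apply: Cn_pair.
  + by apply: (Cn_comp (D' := setT) (g := fst) (f := fst)) => //; exact: Cn_fst.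
  + exact: Cn_snd.
  + by apply: (Cn_comp (D' := setT) (g := snd) (f := fst)) => //;
      [exact: Cn_snd|exact: Cn_fst].
  + exact: Cn_cst.
Unshelve. all: by end_near. Qed.

Lemma evaluation_Csm (i : chart_index A) :
  Csm ([set: 'Cinfty(A, E)] `*` chart_dom i)
    (fun p : 'Cinfty(A, E) * V => p.1 (chart_inv i p.2)).
Proof.
move=> n; apply: (evaluation_Cn n (L := fun (f : 'Cinfty(A, E)) =>
  f \o chart_inv i)) => //.
- exact: Cinfty_tvs_like.
- exact: chart_dom_fat mS gA i.
- by move=> f; exact: csm_on_smooth.
- move=> k f; exact: (proj1 (Cinfty_cvgP id f (nbhs_filter f))
    (@cvg_id _ (nbhs f)) k i).
Qed.

End smooth_function_space.

(** * The action *)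

Lemma half_space_model (R : realType) d : model_set (@half_space R d).
Proof.
split.
- by apply: lcs_tvsType; exact: norm_hausdorff.
- move=> x y t Sx Sy /andP[t0 t1] i i0.
  rewrite !mxE; have xi := Sx i i0; have yi := Sy i i0.
  rewrite (_ : _ + _ = (1 - t) * x ord0 i + t * y ord0 i).
    by rewrite addr_ge0// mulr_ge0// subr_ge0.
  by rewrite mulrBr mulrBl mul1r addrA addrAC.
(* The unit ball around the vector with all entries 1, in the sup norm, has only positive
   coordinates. *)
- exists (const_mx 1); apply/nbhs_ballP; exists 1 => //= y xy i _.
  have := xy.2 ord0 i; rewrite mxE /ball /= ltr_distlC subrr => /andP[yi _].
  exact: ltW.
- rewrite (_ : @half_space R d = \bigcap_(i in [set: 'I_d])
    [set x : 'rV[R]_d | i = 0%N :> nat -> 0 <= x ord0 i]); last first.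
    by apply/seteqP; split=> x h; [move=> i _; exact: h|move=> i; exact: h].
  apply: closed_bigI => i _; have [i0|/eqP i0] := eqVneq (i : nat) 0%N.
    rewrite (_ : mkset _ = (fun x : 'rV[R]_d => x ord0 i) @^-1` [set r | 0 <=
      r]).
      apply: preimage_closed; last exact: closed_ge.
      by move=> x _; exact: coord_continuous.
    by apply/seteqP; split=> x /=; [exact|].
  rewrite (_ : mkset _ = setT); first exact: closedT.
  by apply/seteqP; split=> x //= _ /i0.
- move=> x N /nbhs_ballP[e /= e0 eN].
  (* The closed ball of radius e / 2 in the sup norm, as a product of segments; halving keeps it
     inside the open ball of radius [e]. *)
  exists [set v | forall i : 'I_d, `[x ord0 i - e / 2,
    x ord0 i + e / 2]%classic (v ord0 i)].
  split.
  + by apply: (@rV_compact R d (fun i => `[x ord0 i - e / 2,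
      x ord0 i + e / 2]%classic)) => i; exact: segment_compact.
  + apply/nbhs_ballP; exists (e / 2) => /=; first exact: divr_gt0.
    move=> y xy i; have := xy.2 ord0 i; rewrite /ball /= in_itv /= distrC =>
      /ltW.
    by rewrite ler_distl.
  + move=> y xy; apply: eN; split => // i j; rewrite (ord1 i) /ball /= distrC.
    have := xy j; rewrite /= in_itv /= -ler_distl => /le_lt_trans; apply.
    by rewrite ltr_pdivrMr// ltr_pMr// ltr1n.
Qed.

Lemma manifold_good_atlas (R : realType) T (V : preTopologicalLmodType R)
    (S : set V) (A : atlas T V) :
  model_set S -> is_manifold S A -> good_atlas S A.
Proof.
move=> mS [at_ inv opn trans _]; split => // i j.
apply: smooth_on_Csm (trans i j); last exact: model_lcs mS.
by have [Q oQ ->] := opn i j; exact: model_fat.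
Qed.

Lemma tvsType_tvs_like (R : realType) (V : tvsType R) : tvs_like V.
Proof. by split; [exact: add_continuous|exact: scale_continuous]. Qed.

Section action_on_smooth_functions.
Context {R : realType} {d : nat} {M : Type} {AM : atlas M 'rV[R]_d}.
Context {V : tvsType R} {G : groupType} {AG : atlas G V} {E : tvsType R}.
Hypothesis gM : good_atlas (@half_space R d) AM.
Hypothesis mG : is_manifold setT AG.
Hypothesis lE : lcs E.
Variable sigma : M * G -> M.
Hypothesis sigma_smooth : smooth_map (prod_atlas AM AG) AM sigma.

Let mS := half_space_model R d.
Let tC : tvs_like 'Cinfty(AM, E) := Cinfty_tvs_like mS gM lE.

Lemma group_chart_open (i : chart_index AG) : open (chart i @` dom i).
Proof.
have [_ _ opn _ _] := mG; have [Q oQ] := opn i i.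
by rewrite setIid setIT => ->.
Qed.

Lemma dom_open (b : chart_index AM) : open (dom b : set (mfd AM)).
Proof.
rewrite openE => p bp; rewrite /interior.
have nT : nbhs (chart b p) setT by exact: filterT.
have h := mfd_nbhs_chart gM bp nT.
by apply: (@filterS _ (nbhs (p : mfd AM)) _ _ _ _ h) => q [].
Qed.

(** Near a given point this is evaluation in a chart [b] around the image under [sigma], composed
    with the expression of [sigma] in charts. As [b] depends on the point, the conclusion is drawn
    locally. *)
Lemma action_pullback_Csm (i : chart_index AG) (a : chart_index AM) :
  Csm ((chart i @` dom i `*` [set: 'Cinfty(AM, E)]) `*` chart_dom a)
    (fun p => p.1.2 (sigma (chart_inv a p.2, chart_inv i p.1.1))).
Proof.
have [_ invG _ _ _] := mG.
have oO := group_chart_open i; have tV := tvsType_tvs_like V.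
have fa := chart_dom_fat mS gM a.
have fO : fat (chart i @` dom i) by exact: open_fat.
have fC : fat [set: 'Cinfty(AM, E)] by apply: open_fat => //; exact: openT.
have [sc ss] := sigma_smooth.
apply: Csm_local; first exact: lcs_hausdorff.
  by apply: fat_setX => //; exact: fat_setX.
move=> [[x0 f0] y0] [[/= [g ig gx0] _] [m am my0]].
pose b := chart_at AM (sigma (m, g)).
have bs : dom b (sigma (m, g)) by exact: (good_at gM).
have oP : open (sigma @^-1` dom b : set (mfd (prod_atlas AM AG))).
  by move/continuousP: sc; apply; exact: dom_open.
have [W oW sW] := oP (a, i).
have Wm : W (y0, x0) by rewrite -gx0 -my0; apply/(sW (m, g)).
(* Continuity of [sigma] turns the domain of its chart expression into a product of chart images cut
   by an open [W], hence into a fat set, boundary points included. *)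
have De : chart (a := prod_atlas AM AG) (a, i) @`
      (dom (a := prod_atlas AM AG) (a, i) `&` sigma @^-1` dom b) =
    (chart_dom a `*` (chart i @` dom i)) `&` W.
  apply/seteqP; split.
    move=> _ [[m' g'] [[/= am' ig'] bs'] <-]; split; last exact/(sW (m', g')).
    by split; [exists m'|exists g'].
  move=> [_ _] [[/= [m' am' <-] [g' ig' <-]] Wm']; exists (m', g') => //.
  by split => //; apply/(sW (m', g')).
have fD : fat ((chart_dom a `*` (chart i @` dom i)) `&` W).
  by apply: fat_open_setI => //; exact: fat_setX.
have := ss (a, i) b; rewrite De => /(smooth_on_Csm fD (model_lcs mS)) sb.
exists ((fun p : (V * 'Cinfty(AM, E)) * 'rV[R]_d => (p.2, p.1.1)) @^-1` W).
split => //.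
  have cf : continuous (fun p : (V * 'Cinfty(AM, E)) * 'rV[R]_d => (p.2,
    p.1.1)).
    move=> z; have z1 := cvg_fst_comp (@cvg_id _ (nbhs z)).
    exact: cvg_pair_nbhs (cvg_snd_comp (@cvg_id _ (nbhs z))) (cvg_fst_comp z1).
  by move/continuousP : cf; apply.
move=> n.
have e (p : (V * 'Cinfty(AM, E)) * 'rV[R]_d) :
    (((chart i @` dom i `*` [set: 'Cinfty(AM, E)]) `*` chart_dom a) `&`
      (fun p => (p.2, p.1.1)) @^-1` W) p ->
    p.1.2 (chart_inv b ((chart b \o sigma \o chart_inv (a := prod_atlas AM AG)
      (a, i))
      (p.2, p.1.1))) = p.1.2 (sigma (chart_inv a p.2, chart_inv i p.1.1)).
  case: p => -[x f] y [[[/= [g' ig' <-] _] [m' am' <-]] Wp] /=.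
  rewrite (good_inv gM am') (invG i g' ig') (good_inv gM)//.
  exact/(sW (m', g')).
apply: (Cn_sub (fun _ h => h) e).
have ev := evaluation_Csm mS gM lE b.
pose tau := chart b \o sigma \o chart_inv (a := prod_atlas AM AG) (a, i).
apply: (Cn_comp (D' := [set: 'Cinfty(AM, E)] `*` chart_dom b)
  (g := fun p : 'Cinfty(AM, E) * 'rV[R]_d => p.1 (chart_inv b p.2))
  (f := fun p : (V * 'Cinfty(AM, E)) * 'rV[R]_d => (p.1.2, tau (p.2, p.1.1)))).
- move=> [[x f] y] [[[/= [g' ig' <-] _] [m' am' <-]] Wp]; split => //=.
  rewrite /tau /= (good_inv gM am') (invG i g' ig').
  by exists (sigma (m', g')) => //; exact/(sW (m', g')).
- exact: ev.
- apply: Cn_pair.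
    by apply: (Cn_comp (D' := setT) (g := snd) (f := fst)) => //;
      [exact: Cn_snd|exact: Cn_fst].
  apply: (Cn_comp (f := fun p : (V * 'Cinfty(AM, E)) * 'rV[R]_d => (p.2, p.1.1))
    _ (sb n)).
    by move=> p [[[Op _] ap] Wp]; split.
  apply: Cn_pair; first exact: Cn_snd.
  by apply: (Cn_comp (D' := setT) (g := fst) (f := fst)) => //; exact: Cn_fst.
Qed.

Definition action (p : G * 'Cinfty(AM, E)) : 'Cinfty(AM, E) :=
  to_Cinfty AM (fun m => p.2 (sigma (m, p.1))).

(** The default value of [to_Cinfty] is never taken: smoothness of f o sigma(-, g) follows by
    freezing the group and function variables in [action_pullback_Csm]. *)
Lemma actionE g (f : 'Cinfty(AM, E)) m : action (g, f) m = f (sigma (m, g)).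
Proof.
have [atG invG _ _ _] := mG; rewrite /action (to_CinftyE mS gM lE)// => a n.
pose i := chart_at AG g; have ig := atG g.
pose F (p : (V * 'Cinfty(AM, E)) * 'rV[R]_d) :=
  p.1.2 (sigma (chart_inv a p.2, chart_inv i p.1.1)).
have e (y : 'rV[R]_d) : chart_dom a y -> F ((chart i g, f), y) =
    ((fun m => f (sigma (m, g))) \o chart_inv a) y.
  by move=> _; rewrite /F /= (invG i g ig).
apply: (Cn_sub (fun _ h => h) e).
apply: (Cn_comp (f := fun y : 'rV[R]_d => ((chart i g, f), y)) _
  (action_pullback_Csm i a n)).
  by move=> y ay; split => //; split => //; exists g.
have tV := tvsType_tvs_like V.
by apply: Cn_pair; [apply: Cn_cst; exact: tvs_like_prod|apply: Cn_lin => // x;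
  exact: cvg_id].
Qed.

Lemma action_Csm (i : chart_index AG) :
  Csm (chart i @` dom i `*` [set: 'Cinfty(AM, E)])
    (fun p : V * 'Cinfty(AM, E) => action (chart_inv i p.1, p.2)).
Proof.
move=> n; apply: (exponential_Cn mS gM lE).
- by apply: tvs_like_prod => //; exact: tvsType_tvs_like.
- by apply: open_setX; [exact: group_chart_open|exact: openT].
- move=> a k; apply: Cn_sub (action_pullback_Csm i a k) => //.
  by move=> p _; rewrite actionE.
Qed.

Lemma action_smooth : smooth_map (prod_atlas AG (space_atlas 'Cinfty(AM, E)))
  (space_atlas 'Cinfty(AM, E)) action.
Proof.
have [_ invG _ _ _] := mG; have tV := tvsType_tvs_like V.
have oD (i : chart_index AG) : open (chart i @` dom i `*` [set: 'Cinfty(AM,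
  E)]).
  by apply: open_setX; [exact: group_chart_open|exact: openT].
split.
  apply/continuousP => B /(_ tt)[B' oB' BB'].
  suff : mfd_open (action @^-1` B :
    set (mfd (prod_atlas AG (space_atlas 'Cinfty(AM, E))))) by [].
  move=> [i []].
  pose f := fun p : V * 'Cinfty(AM, E) => action (chart_inv i p.1, p.2).
  (* The expression [f] is controlled only on the chart image; as that image is open, so is its
     intersection with the preimage of [B']. *)
  exists (chart i @` dom i `*` [set: 'Cinfty(AM, E)] `&` f @^-1` B').
    rewrite openE => z [Dz Bz].
    have nD : nbhs z (chart i @` dom i `*` [set: 'Cinfty(AM, E)]).
      by apply: open_nbhs_nbhs; split => //; exact: oD.
    have fz := cont_on_within (Cn_cont (action_Csm i 0%N)) Dz.
    have wB : within (chart i @` dom i `*` [set: 'Cinfty(AM, E)]) (nbhs z)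
      (f @^-1` B').
      by apply: fz; exact: open_nbhs_nbhs.
    by apply: filterS2 nD wB => p Dp h; split => //; exact: h.
  move=> [g f'] [/= ig _]; rewrite /f /= (invG i g ig).
  split=> [/BB' h|[_ h]]; last exact/BB'.
  by split; [split => //; exists g|exact: h].
move=> [i []] [].
have -> : chart (a := prod_atlas AG (space_atlas 'Cinfty(AM, E))) (i, tt) @`
    (dom (a := prod_atlas AG (space_atlas 'Cinfty(AM, E))) (i, tt) `&`
      action @^-1` dom (a := space_atlas 'Cinfty(AM, E)) tt) =
    chart i @` dom i `*` [set: 'Cinfty(AM, E)].
  apply/seteqP; split.
    by move=> _ [[g f] [[/= ig _] _] <-]; split => //; exists g.
  by move=> [_ f] [/= [g ig <-] _]; exists (g, f).
apply: Csm_smooth_on (action_Csm i).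
- exact: Cinfty_hausdorff mS gM lE.
- by apply: open_fat => //; exact: tvs_like_prod.
Qed.

End action_on_smooth_functions.

Theorem proposition2p1 (R : realType)
  (d : nat) (M : Type) (AM : atlas M 'rV[R]_d)
  (HM : is_fin_manifold_with_boundary AM)
  (V : tvsType R) (HV : hausdorff_space V)
  (G : groupType) (AG : atlas G V) (HG : is_lie_group AG)
  (sigma : M * G -> M) (Hsigma : is_right_action sigma)
  (sigma_smooth : smooth_map (prod_atlas AM AG) AM sigma)
  (E : tvsType R) (HE : hausdorff_space E) :
  exists alpha : G * 'Cinfty(AM, E) -> 'Cinfty(AM, E),
    [/\ forall (g : G) (f : 'Cinfty(AM, E)) (m : M),
          alpha (g, f) m = f (sigma (m, g)),
        is_left_action alpha
      & smooth_map (prod_atlas AG (space_atlas 'Cinfty(AM, E)))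
                   (space_atlas 'Cinfty(AM, E)) alpha].
Proof.
have [mM _ _] := HM; have [mG _ _] := HG.
have gM := manifold_good_atlas (half_space_model R d) mM.
have lE := lcs_tvsType HE.
have aE := actionE gM mG lE sigma_smooth.
exists (action sigma); split => //; last exact: action_smooth.
have [s1 sM] := Hsigma.
split=> [f|g h f]; apply: val_inj; apply/funext => m.
  by rewrite [LHS]aE s1.
by rewrite [LHS]aE [LHS]aE [RHS]aE sM.
Qed.
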